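(* Given a range-restricted $\mathrm{CHR}(C)$ program $P$ and a goal $G$, the existence of an infinite computation for $G$ in $P$ under the abstract operational semantics $\omega_o$ is decidable.
   Context: $\mathrm{CHR}(C)$ is Constraint Handling Rules over a signature with no function symbols of arity $>0$ (terms are variables and constants), with the only built-in constraint $=$ (plus $true,false$), interpreted as syntactic equality on the Herbrand universe. A rule $r\,@\,H^k\setminus H^h \Longleftrightarrow g\mid B$ ($H^k,H^h$ multisets of CHR atoms not both empty, $g$ conjunction of built-ins, $B$ multiset of built-in and CHR constraints) is range-restricted if $Var(B)\cup Var(g)\subseteq Var(H^k,H^h)$; a program is range-restricted if all its rules are. The semantics $\omega_o$ has configurations $\langle G,S,B\rangle_n$ and transitions: Solve $\langle\{c\}\uplus G,S,B\rangle_n\to\langle G,S,c\wedge B\rangle_n$ ($c$ built-in); Introduce $\langle\{c\}\uplus G,S,B\rangle_n\to\langle G,\{c\#n\}\cup S,B\rangle_{n+1}$ ($c$ CHR constraint); Apply $\langle G,H_1\cup H_2\cup S,B\rangle_n\to\langle C\uplus G,H_1\cup S,\theta\wedge B\rangle_n$ for a renamed-apart rule $r\,@\,H_1'\setminus H_2'\Longleftrightarrow g\mid C$ of $P$ and matching substitution $\theta$ with $\mathrm{chr}(H_1)=H_1'\theta$, $\mathrm{chr}(H_2)=H_2'\theta$, $\mathcal{CT}\models B\rightarrow\exists_{-Fv(B)}(\theta\wedge g)$. A computation for $G$ starts from the initial configuration $\langle G,\emptyset,true\rangle_1$; it is terminating if it ends in a final configuration (either $\langle G',S,false\rangle_k$,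 or $\langle\emptyset,S,B\rangle_k$ with no applicable rule), and infinite otherwise. *)

(* Defs.v *)
From HB Require Import structures.
From mathcomp Require Import all_boot.

Set Implicit Arguments.
Unset Strict Implicit.
Unset Printing Implicit Defensive.

(** * CHR(C): syntax *)

(* The signature has a countable type [C] of constants and no function symbol
   of positive arity, so the Herbrand universe is [C] itself.  Variables are
   natural numbers. *)
Inductive term (C : Type) : Type := Var of nat | Cst of C.
Arguments Var {C} _.

Section TermEq.
Variable C : countType.
Definition sum_of_term (t : term C) : nat + C :=
  match t with Var x => inl x | Cst c => inr c end.
Definition term_of_sum (s : nat + C) : term C :=
  match s with inl x => Var x | inr c => Cst c end.
Lemma sum_of_termK : cancel sum_of_term term_of_sum. Proof. by case. Qed.
HB.instance Definition _ := Countable.copy (term C) (can_type sum_of_termK).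
End TermEq.

Inductive builtin (C : Type) : Type :=
  | BTrue
  | BFalse
  | BEq of term C & term C.
Arguments BTrue {C}.
Arguments BFalse {C}.

Section BuiltinEq.
Variable C : countType.
Definition sum_of_builtin (b : builtin C) : bool + term C * term C :=
  match b with BTrue => inl true | BFalse => inl false
             | BEq t u => inr (t, u) end.
Definition builtin_of_sum (s : bool + term C * term C) : builtin C :=
  match s with inl true => BTrue | inl false => BFalse
             | inr (t, u) => BEq t u end.
Lemma sum_of_builtinK : cancel sum_of_builtin builtin_of_sum.
Proof. by case. Qed.
HB.instance Definition _ :=
  Countable.copy (builtin C) (can_type sum_of_builtinK).
End BuiltinEq.

(* A CHR constraint symbol is a name together with its arity, so [(p, ts)] is
   an atom for the symbol [p] of arity [size ts]. *)
Notation atom C := (nat * seq (term C))%type.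
Notation constr C := (builtin C + atom C)%type.

(* Multisets are sequences considered up to [perm_eq]; conjunctions of built-in
   constraints are sequences, the empty one being true. *)
Record rule (C : Type) : Type := Rule {
  kept    : seq (atom C);     (* H^k *)
  removed : seq (atom C);     (* H^h *)
  guard   : seq (builtin C);
  body    : seq (constr C) }.

Section RuleEq.
Variable C : countType.
Definition tuple_of_rule (r : rule C) :=
  (kept r, removed r, guard r, body r).
Definition rule_of_tuple
    (x : seq (atom C) * seq (atom C) * seq (builtin C) * seq (constr C)) :=
  let: (k, h, g, b) := x in Rule k h g b.
Lemma tuple_of_ruleK : cancel tuple_of_rule rule_of_tuple.
Proof. by case. Qed.
HB.instance Definition _ := Countable.copy (rule C) (can_type tuple_of_ruleK).
End RuleEq.

Notation program C := (seq (rule C)).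
Notation goal C := (seq (constr C)).

Section Syntax.
Variable C : countType.

Definition tvars (t : term C) : seq nat := if t is Var x then [:: x] else [::].
Definition avars (a : atom C) : seq nat := flatten (map tvars a.2).
Definition bvars (b : builtin C) : seq nat :=
  if b is BEq t u then tvars t ++ tvars u else [::].
Definition cvars (c : constr C) : seq nat :=
  match c with inl b => bvars b | inr a => avars a end.

Definition heads (r : rule C) : seq (atom C) := kept r ++ removed r.
Definition head_vars (r : rule C) : seq nat := flatten (map avars (heads r)).
Definition guard_vars (r : rule C) : seq nat := flatten (map bvars (guard r)).
Definition body_vars (r : rule C) : seq nat := flatten (map cvars (body r)).
Definition rule_vars (r : rule C) : seq nat :=
  head_vars r ++ guard_vars r ++ body_vars r.

Definition is_chr_program (P : program C) : Prop :=
  forall r, r \in P -> heads r != [::].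

Definition rule_range_restricted (r : rule C) : Prop :=
  {subset body_vars r ++ guard_vars r <= head_vars r}.

Definition range_restricted (P : program C) : Prop :=
  forall r, r \in P -> rule_range_restricted r.

Section Subst.
Variable s : nat -> term C.
Definition tsubst (t : term C) : term C := if t is Var x then s x else t.
Definition asubst (a : atom C) : atom C := (a.1, map tsubst a.2).
Definition bsubst (b : builtin C) : builtin C :=
  if b is BEq t u then BEq (tsubst t) (tsubst u) else b.
Definition csubst (c : constr C) : constr C :=
  match c with inl b => inl (bsubst b) | inr a => inr (asubst a) end.
Definition rsubst (r : rule C) : rule C :=
  Rule (map asubst (kept r)) (map asubst (removed r))
       (map bsubst (guard r)) (map csubst (body r)).
End Subst.

Definition rename (rho : nat -> nat) (r : rule C) : rule C :=
  rsubst (fun x => Var (rho x)) r.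

(* A substitution with domain [xs], read as a conjunction of equations. *)
Definition subst_eqs (xs : seq nat) (theta : nat -> term C) :
    seq (builtin C) :=
  [seq BEq (Var x) (theta x) | x <- undup xs].

(** * The constraint theory: syntactic equality on the Herbrand universe *)

Definition tval (v : nat -> C) (t : term C) : C :=
  match t with Var x => v x | Cst c => c end.

Definition bsat (v : nat -> C) (b : builtin C) : bool :=
  match b with
  | BTrue => true
  | BFalse => false
  | BEq t u => tval v t == tval v u
  end.

Definition sat (v : nat -> C) (B : seq (builtin C)) : bool := all (bsat v) B.

Definition fv (B : seq (builtin C)) : seq nat := flatten (map bvars B).

(* CT |= B -> exists_{-Fv(B)} D : every variable outside [fv B] is quantified
   existentially. *)
Definition entails_ex (B D : seq (builtin C)) : Prop :=
  forall v, sat v B -> exists2 w, {in fv B, w =1 v} & sat w D.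

(** * The abstract operational semantics *)

(* The identified constraint c#n is the pair [(c, n)]. *)
Record config : Type := Config {
  cgoal  : goal C;
  cstore : seq (atom C * nat);
  cbuilt : seq (builtin C);
  cnext  : nat }.

Definition chr (S : seq (atom C * nat)) : seq (atom C) := map fst S.

Definition config_vars (k : config) : seq nat :=
  flatten (map cvars (cgoal k)) ++ flatten (map avars (chr (cstore k)))
  ++ fv (cbuilt k).

Definition initial (G : goal C) : config := Config G [::] [:: BTrue] 1.

Section Transitions.
Variable P : program C.

Inductive solve : config -> config -> Prop :=
  Solve c G G' S B n of perm_eq G' (inl c :: G) :
    solve (Config G' S B n) (Config G S (c :: B) n).

Inductive introduce : config -> config -> Prop :=
  Introduce c G G' S B n of perm_eq G' (inr c :: G) :
    introduce (Config G' S B n) (Config G ((c, n) :: S) B n.+1).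

(* [r'] is a variant of the program rule [r], renamed apart from the current
   configuration.  The substitution [theta] acts on the head variables of
   [r']; the guard is checked but not added to the built-in store. *)
Inductive apply_rule : config -> config -> Prop :=
  Apply (r : rule C) (rho : nat -> nat) (theta : nat -> term C)
        G S S' H1 H2 B n
        (r' := rename rho r)
        (eqs := subst_eqs (head_vars r') theta) of
    r \in P &
    {in rule_vars r &, injective rho} &
    (forall x, x \in rule_vars r' -> x \notin config_vars (Config G S' B n)) &
    perm_eq S' (H1 ++ H2 ++ S) &
    perm_eq (chr H1) (map (asubst theta) (kept r')) &
    perm_eq (chr H2) (map (asubst theta) (removed r')) &
    entails_ex B (eqs ++ guard r') :
    apply_rule (Config G S' B n)
               (Config (body r' ++ G) (H1 ++ S) (eqs ++ B) n).

Definition step (k k' : config) : Prop :=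
  [\/ solve k k', introduce k k' | apply_rule k k'].

(* The built-in store counts as [false] when it is equivalent to [false],
   i.e. unsatisfiable: stores are accumulated as conjunctions and never
   simplified. *)
Definition failed (k : config) : Prop := forall v, ~~ sat v (cbuilt k).

Definition successful (k : config) : Prop :=
  cgoal k = [::] /\ ~ exists k', apply_rule k k'.

Definition final (k : config) : Prop := failed k \/ successful k.

(* A computation stops as soon as it reaches a final configuration, hence no
   configuration of an infinite computation is final. *)
Definition infinite_computation (G : goal C) (k : nat -> config) : Prop :=
  k 0 = initial G /\ forall i, ~ final (k i) /\ step (k i) (k i.+1).

End Transitions.

(** * Effective encoding of programs and goals *)

(* [CodeSeq.code] is a computable bijection from [seq nat] to [nat]. *)
Definition code_term (t : term C) : nat :=
  match t with
  | Var x => CodeSeq.code [:: 0; x]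
  | Cst c => CodeSeq.code [:: 1; pickle c]
  end.

Definition code_atom (a : atom C) : nat :=
  CodeSeq.code (a.1 :: map code_term a.2).

Definition code_builtin (b : builtin C) : nat :=
  match b with
  | BTrue => CodeSeq.code [:: 0]
  | BFalse => CodeSeq.code [:: 1]
  | BEq t u => CodeSeq.code [:: 2; code_term t; code_term u]
  end.

Definition code_constr (c : constr C) : nat :=
  match c with
  | inl b => CodeSeq.code [:: 0; code_builtin b]
  | inr a => CodeSeq.code [:: 1; code_atom a]
  end.

Definition code_goal (G : goal C) : nat := CodeSeq.code (map code_constr G).

Definition code_rule (r : rule C) : nat :=
  CodeSeq.code [:: CodeSeq.code (map code_atom (kept r));
                   CodeSeq.code (map code_atom (removed r));
                   CodeSeq.code (map code_builtin (guard r));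
                   code_goal (body r)].

Definition code_program (P : program C) : nat :=
  CodeSeq.code (map code_rule P).

Definition code_instance (x : program C * goal C) : nat :=
  CodeSeq.code [:: code_program x.1; code_goal x.2].

End Syntax.

(** * Decidability: partial recursive functions *)

Inductive recfun : Type :=
  | RZero
  | RSucc
  | RProj of nat
  | RComp of recfun & seq recfun
  | RRec of recfun & recfun
  | RMu of recfun.

(* [reval f xs y]: the partial recursive function [f] is defined on the
   arguments [xs], with value [y].  Arities are not enforced statically: a
   basic function ignores superfluous arguments and is undefined when an
   argument it uses is missing. *)
Inductive reval : recfun -> seq nat -> nat -> Prop :=
  | EvZero xs : reval RZero xs 0
  | EvSucc x xs : reval RSucc (x :: xs) x.+1
  | EvProj i xs of i < size xs : reval (RProj i) xs (nth 0 xs i)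
  | EvComp f gs xs ys y of
      size ys = size gs &
      (forall i, i < size gs -> reval (nth RZero gs i) xs (nth 0 ys i)) &
      reval f ys y :
      reval (RComp f gs) xs y
  | EvRec0 f g xs y of reval f xs y : reval (RRec f g) (0 :: xs) y
  | EvRecS f g n xs z y of
      reval (RRec f g) (n :: xs) z & reval g (n :: z :: xs) y :
      reval (RRec f g) (n.+1 :: xs) y
  | EvMu f xs n (z : nat -> nat) of
      (forall m, m < n -> reval f (m :: xs) (z m).+1) &
      reval f (n :: xs) 0 :
      reval (RMu f) xs n.

(* [A] is decidable on the inputs satisfying [D], where inputs are presented to
   the recursive function through [code].  Stating this with a [bool]-valued or
   [sumbool]-valued function of the logic would be trivial under classical
   choice. *)
Definition decidable_on (X : Type) (code : X -> nat) (D A : X -> Prop) : Prop :=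
  exists f : recfun, forall x, D x ->
    (A x -> reval f [:: code x] 1) /\ (~ A x -> reval f [:: code x] 0).

(* Main.v *)
(* Configurations are abstracted into finite multisets of clusters, a cluster
   being what remains of one instance of a rule body.  A rule instance renames
   all its variables afresh, and range restriction makes each of them equal, in
   the built-in store, to one of the finitely many terms of the goal and of the
   program.  So terms of distinct clusters are never syntactically equal unless
   they are constants, and up to renaming only finitely many clusters and
   built-in constraints exist.  Adding clusters without changing the built-in
   store disables no transition.  By Dickson's lemma an infinite computation
   therefore contains a state covered, with the same built-in store, by a later
   one; conversely a path with such a pair can be repeated forever.  By Koenig's
   lemma, if there is no infinite computation then the lengths of the abstract
   paths are bounded.  Enumerating the paths of length n = 0, 1, ... until one
   covers itself or none is left decides the question. *)

From HB Require Import structures.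
From mathcomp Require Import all_boot.
From Stdlib Require Import Classical ClassicalEpsilon.
Require Import Defs.

Set Implicit Arguments.
Unset Strict Implicit.
Unset Printing Implicit Defensive.

(** * Recursive functions on encoded data *)

(** Heads are matched up to syntactic equality, whereas guards are checked modulo the built-in
    store. An abstract term therefore carries two data: a token, which identifies it syntactically,
    and a root, which represents its value. Guard checking also depends on which variables are free
    in the store, as [entails_ex] quantifies existentially over all others; so the abstract store
    must reproduce both the solutions and the free variables of the concrete one, and [simulates]
    records both. Its parameter [ex] holds the constraints that the abstract state has forgotten:
    closing a loop consists in moving surplus clusters into [ex]. This is why completeness is proved
    with [ex] empty and soundness with [ex] arbitrary. Distinct terms that may not be bound clash
    only if the universe has two elements, hence the parameter [single], which is fixed by [C] and
    not computed. Finally, decidability asks for an explicit [recfun], so the search is written with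
    total list combinators, whose computability is derived once and for all. *)

Lemma reval_comp1 f g xs a y :
  reval f [:: a] y -> reval g xs a -> reval (RComp f [:: g]) xs y.
Proof. by move=> Hf Hg; apply: (EvComp (ys := [:: a])) => // -[]. Qed.

Lemma reval_comp2 f g h xs a b y :
  reval f [:: a; b] y -> reval g xs a -> reval h xs b ->
  reval (RComp f [:: g; h]) xs y.
Proof. by move=> *; apply: (EvComp (ys := [:: a; b])) => // -[|[]]. Qed.

Lemma reval_comp3 f g h i xs a b c y :
  reval f [:: a; b; c] y -> reval g xs a -> reval h xs b -> reval i xs c ->
  reval (RComp f [:: g; h; i]) xs y.
Proof. by move=> *; apply: (EvComp (ys := [:: a; b; c])) => // -[|[|[]]]. Qed.

Lemma reval_proj i xs y : i < size xs -> nth 0 xs i = y -> reval (RProj i) xs y.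
Proof. by move=> hi <-; constructor. Qed.

Ltac rproj := by apply: reval_proj.

Lemma reval_succ f xs a : reval f xs a -> reval (RComp RSucc [:: f]) xs a.+1.
Proof. by apply: reval_comp1; constructor. Qed.

Fixpoint rconst n : recfun := if n is m.+1 then RComp RSucc [:: rconst m] else RZero.

Lemma rconstP n xs : reval (rconst n) xs n.
Proof. by elim: n => [|n IHn] /=; [constructor | apply: reval_succ]. Qed.

Definition radd := RRec (RProj 0) (RComp RSucc [:: RProj 1]).
Lemma raddP n m : reval radd [:: n; m] (n + m).
Proof.
elim: n => [|n IHn]; first by apply: EvRec0; rproj.
by apply: EvRecS IHn _; rewrite addSn; apply: reval_succ; rproj.
Qed.

Definition rpred := RRec RZero (RProj 0).
Lemma rpredP n : reval rpred [:: n] n.-1.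
Proof.
elim: n => [|n IHn]; first by apply: EvRec0; constructor.
by apply: EvRecS IHn _; rproj.
Qed.

(* The subtrahend comes first. *)
Definition rsub := RRec (RProj 0) (RComp rpred [:: RProj 1]).
Lemma rsubP n m : reval rsub [:: n; m] (m - n).
Proof.
elim: n => [|n IHn]; first by apply: EvRec0; rewrite subn0; rproj.
apply: EvRecS IHn _; rewrite subnS.
by apply: reval_comp1 (rpredP _) _; rproj.
Qed.

Definition rnot := RRec (rconst 1) RZero.
Lemma rnotP n : reval rnot [:: n] (n == 0).
Proof.
elim: n => [|n IHn]; first by apply: EvRec0; apply: rconstP.
by apply: EvRecS IHn _; constructor.
Qed.

Definition rif := RRec (RProj 1) (RProj 2).
Lemma rifP n a b : reval rif [:: n; a; b] (if n == 0 then b else a).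
Proof.
elim: n => [|n IHn]; first by apply: EvRec0; rproj.
by apply: EvRecS IHn _; rproj.
Qed.

Definition req :=
  RComp rnot [:: RComp radd [:: rsub; RComp rsub [:: RProj 1; RProj 0]]].
Lemma reqP n m : reval req [:: n; m] (n == m).
Proof.
have -> : (n == m) = ((m - n) + (n - m) == 0).
  by rewrite addn_eq0 !subn_eq0 eqn_leq andbC.
apply: reval_comp1 (rnotP _) _; apply: reval_comp2 (raddP _ _) (rsubP _ _) _.
by apply: reval_comp2 (rsubP _ _) _ _; rproj.
Qed.

Definition rleq := RComp rnot [:: RComp rsub [:: RProj 1; RProj 0]].
Lemma rleqP n m : reval rleq [:: n; m] (n <= m).
Proof.
rewrite -subn_eq0; apply: reval_comp1 (rnotP _) _.
by apply: reval_comp2 (rsubP _ _) _ _; rproj.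
Qed.

Definition rodd := RRec RZero (RComp rnot [:: RProj 1]).
Lemma roddP n : reval rodd [:: n] (odd n).
Proof.
elim: n => [|n IHn]; first by apply: EvRec0; constructor.
apply: EvRecS IHn _; rewrite oddS.
have -> : ~~ odd n = ((odd n : nat) == 0) by case: odd.
by apply: reval_comp1 (rnotP _) _; rproj.
Qed.

Definition rhalf := RRec RZero (RComp radd [:: RComp rodd [:: RProj 0]; RProj 1]).
Lemma rhalfP n : reval rhalf [:: n] n./2.
Proof.
elim: n => [|n IHn]; first by apply: EvRec0; constructor.
apply: EvRecS IHn _; rewrite /= uphalf_half.
apply: reval_comp2 (raddP _ _) _ _; last by rproj.
by apply: reval_comp1 (roddP _) _; rproj.
Qed.

Definition riter f := RRec (RProj 0) (RComp f [:: RProj 1]).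
Lemma riterP f F n m : (forall x, reval f [:: x] (F x)) ->
  reval (riter f) [:: n; m] (iter n F m).
Proof.
move=> Hf; elim: n => [|n IHn]; first by apply: EvRec0; rproj.
by apply: EvRecS IHn _; apply: reval_comp1 (Hf _) _; rproj.
Qed.

(* [CodeSeq.code (n :: s)] is [consn n (CodeSeq.code s)]. *)
Definition consn (n m : nat) : nat := 2 ^ n * m.*2.+1.

Lemma iter_doubleE n m : iter n double m = 2 ^ n * m.
Proof. by elim: n => [|n IHn]; rewrite ?mul1n //= IHn expnS -mulnA mul2n. Qed.

Definition rdouble := RComp radd [:: RProj 0; RProj 0].
Lemma rdoubleP n : reval rdouble [:: n] n.*2.
Proof. by rewrite -addnn; apply: reval_comp2 (raddP _ _) _ _; rproj. Qed.

Definition rconsn :=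
  RComp (riter rdouble) [:: RProj 0; RComp RSucc [:: RComp rdouble [:: RProj 1]]].
Lemma rconsnP n m : reval rconsn [:: n; m] (consn n m).
Proof.
rewrite /consn -iter_doubleE.
apply: reval_comp2 (riterP _ _ rdoubleP) _ _; first by rproj.
by apply: reval_succ; apply: reval_comp1 (rdoubleP _) _; rproj.
Qed.

Lemma consn_gt0 n m : 0 < consn n m.
Proof. by rewrite muln_gt0 expn_gt0. Qed.

Lemma iter_half_consn k n m : k <= n -> iter k half (consn n m) = consn (n - k) m.
Proof.
elim: k => [|k IHk] kn; first by rewrite subn0.
rewrite /= (IHk (ltnW kn)) /consn -(subnSK kn) expnS -mulnA mul2n doubleK //.
Qed.

(** The head of a list code is its 2-adic valuation: the search stops at the first [n] for which [n]
    halvings leave an odd number. On 0, the code of the empty list, it stops at once. *)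
Definition rhd :=
  RMu (RComp rif [:: RProj 1; RComp rnot [:: RComp rodd [:: riter rhalf]]; RZero]).

Lemma rhd_testP n c :
  reval (RComp rif [:: RProj 1; RComp rnot [:: RComp rodd [:: riter rhalf]]; RZero])
    [:: n; c] ((c != 0) && ~~ odd (iter n half c)).
Proof.
have -> : ((c != 0) && ~~ odd (iter n half c) : nat) =
  if c == 0 then 0 else ((odd (iter n half c) : nat) == 0) by case: eqP; case: odd.
apply: reval_comp3 (rifP _ _ _) _ _ _; [rproj | | by constructor].
by apply: reval_comp1 (rnotP _) _; apply: reval_comp1 (roddP _) (riterP _ _ rhalfP).
Qed.

(** [rif] evaluates both of its branches, so list operations need a value even on the code of the
    empty list. *)
Lemma rhd0 : reval rhd [:: 0] 0.
Proof. by apply: (EvMu (z := id)) (rhd_testP 0 0). Qed.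

Lemma rhdP n m : reval rhd [:: consn n m] n.
Proof.
have c0 : consn n m != 0 by rewrite -lt0n consn_gt0.
apply: (EvMu (z := fun=> 0)) => [k kn|].
  have := rhd_testP k (consn n m).
  rewrite c0 iter_half_consn ?(ltnW kn) // /consn oddM oddX.
  by have -> : (n - k == 0) = false by apply/negbTE; rewrite -lt0n subn_gt0.
have := rhd_testP n (consn n m).
by rewrite iter_half_consn // subnn /consn mul1n /= odd_double c0.
Qed.

Definition rtl := RComp rhalf [:: RComp (riter rhalf) [:: rhd; RProj 0]].
Lemma rtl0 : reval rtl [:: 0] 0.
Proof.
apply: reval_comp1 (rhalfP 0) _.
by apply: reval_comp2 (riterP _ _ rhalfP) rhd0 _; rproj.
Qed.

Lemma rtlP n m : reval rtl [:: consn n m] m.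
Proof.
have {2}-> : m = (iter n half (consn n m))./2.
  by rewrite iter_half_consn // subnn /consn mul1n /= uphalf_double.
apply: reval_comp1 (rhalfP _) _.
by apply: reval_comp2 (riterP _ _ rhalfP) (rhdP _ _) _; rproj.
Qed.

Lemma rtl_codeP s : reval rtl [:: CodeSeq.code s] (CodeSeq.code (behead s)).
Proof. by case: s => [|n s]; [apply: rtl0 | apply: rtlP]. Qed.

Lemma rdropP n s :
  reval (riter rtl) [:: n; CodeSeq.code s] (CodeSeq.code (drop n s)).
Proof.
elim: n => [|n IHn]; first by apply: EvRec0; rewrite drop0; rproj.
apply: EvRecS IHn _; rewrite -[n.+1]add1n -drop_drop drop1.
by apply: reval_comp1 (rtl_codeP _) _; rproj.
Qed.

(** Codes of nonempty lists are positive, so the first iterated tail equal to 0 counts the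
    elements. *)
Definition rsize := RMu (riter rtl).
Lemma rsizeP s : reval rsize [:: CodeSeq.code s] (size s).
Proof.
apply: (EvMu (z := fun k => (CodeSeq.code (drop k s)).-1)) => [k ks|].
  have := rdropP k s; rewrite (drop_nth 0 ks) /= prednK //.
  exact: consn_gt0.
by have := rdropP (size s) s; rewrite drop_size.
Qed.

(** * Computable functions on encoded types *)

Class Enc (X : Type) := { enc : X -> nat; enc_inj : injective enc }.

#[export] Instance enc_nat : Enc nat := {| enc := id; enc_inj := @inj_id nat |}.

Lemma consn_inj n m n' m' : consn n m = consn n' m' -> n = n' /\ m = m'.
Proof.
move=> E; have K := CodeSeq.decodeK; rewrite -(K m) -(K m') in E.
have /(can_inj CodeSeq.codeK) Ec :
  CodeSeq.code (n :: CodeSeq.decode m) = CodeSeq.code (n' :: CodeSeq.decode m') by [].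
have [En Em] : n = n' /\ CodeSeq.decode m = CodeSeq.decode m' by case: Ec.
by rewrite -(K m) -(K m') Em.
Qed.

Lemma nat_of_bool_inj : injective nat_of_bool.
Proof. by case; case. Qed.
#[export] Instance enc_bool : Enc bool := {| enc_inj := nat_of_bool_inj |}.

Section EncProdSeq.
Variables (X Y : Type) (eX : Enc X) (eY : Enc Y).

Definition enc_pair (p : X * Y) := consn (enc p.1) (enc p.2).
Lemma enc_pair_inj : injective enc_pair.
Proof. by move=> [x y] [x' y'] /consn_inj [Ex Ey]; congr pair; apply: enc_inj. Qed.
#[export] Instance enc_prod : Enc (X * Y) := {| enc_inj := enc_pair_inj |}.

Definition enc_list (s : seq X) := CodeSeq.code (map enc s).
Lemma enc_list_inj : injective enc_list.
Proof. by move=> s t /(can_inj CodeSeq.codeK) /(inj_map enc_inj). Qed.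
#[export] Instance enc_seq : Enc (seq X) := {| enc_inj := enc_list_inj |}.
End EncProdSeq.

(** All arguments are packed into one environment coded by a single number. A function under a
    binder becomes a function of the larger environment [E * X], so that combinators such as [foldr]
    stay within this unary notion. *)
Definition cpt (E X : Type) {eE : Enc E} {eX : Enc X} (f : E -> X) : Prop :=
  exists r, forall e, reval r [:: enc e] (enc (f e)).

Section Cpt.
Variables (E : Type) (eE : Enc E).

Lemma cpt_const X (eX : Enc X) (x : X) : cpt (fun e : E => x).
Proof. by exists (rconst (enc x)) => e; apply: rconstP. Qed.

Lemma cpt_id : cpt (fun e : E => e).
Proof. by exists (RProj 0) => e; rproj. Qed.

Lemma cpt_prim1 X Y (eX : Enc X) (eY : Enc Y) (f : X -> Y) (a : E -> X) :
  cpt f -> cpt a -> cpt (fun e => f (a e)).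
Proof.
move=> [rf Hf] [ra Ha]; exists (RComp rf [:: ra]) => e.
exact: reval_comp1 (Hf _) (Ha _).
Qed.

Lemma cpt_pair X Y (eX : Enc X) (eY : Enc Y) (a : E -> X) (b : E -> Y) :
  cpt a -> cpt b -> cpt (fun e => (a e, b e)).
Proof.
move=> [ra Ha] [rb Hb]; exists (RComp rconsn [:: ra; rb]) => e.
exact: reval_comp2 (rconsnP _ _) (Ha _) (Hb _).
Qed.

Lemma cpt_cons X (eX : Enc X) (a : E -> X) (s : E -> seq X) :
  cpt a -> cpt s -> cpt (fun e => a e :: s e).
Proof.
move=> [ra Ha] [rs Hs]; exists (RComp rconsn [:: ra; rs]) => e.
exact: reval_comp2 (rconsnP _ _) (Ha _) (Hs _).
Qed.

Lemma cpt_proj1 X (eX : Enc X) : cpt (@fst E X).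
Proof. by exists rhd => e; apply: rhdP. Qed.

Lemma cpt_proj2 X (eX : Enc X) : cpt (@snd E X).
Proof. by exists rtl => e; apply: rtlP. Qed.

Lemma cpt_fst X Y (eX : Enc X) (eY : Enc Y) (a : E -> X * Y) :
  cpt a -> cpt (fun e => (a e).1).
Proof. by apply: cpt_prim1; exists rhd => e; apply: rhdP. Qed.

Lemma cpt_snd X Y (eX : Enc X) (eY : Enc Y) (a : E -> X * Y) :
  cpt a -> cpt (fun e => (a e).2).
Proof. by apply: cpt_prim1; exists rtl => e; apply: rtlP. Qed.

Lemma cpt_if X (eX : Enc X) (b : E -> bool) (x y : E -> X) :
  cpt b -> cpt x -> cpt y -> cpt (fun e => if b e then x e else y e).
Proof.
move=> [rb Hb] [rx Hx] [ry Hy]; exists (RComp rif [:: rb; rx; ry]) => e.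
apply: reval_comp3 (Hb e) (Hx e) (Hy e).
by have := rifP (b e) (enc (x e)) (enc (y e)); case: (b e).
Qed.

(** Equality of values is equality of codes; this is what injectivity of [enc] is for. *)
Lemma cpt_eq (X : eqType) (eX : Enc X) (a b : E -> X) :
  cpt a -> cpt b -> cpt (fun e => a e == b e).
Proof.
move=> [ra Ha] [rb Hb]; exists (RComp req [:: ra; rb]) => e.
rewrite -(inj_eq enc_inj).
exact: reval_comp2 (reqP _ _) (Ha _) (Hb _).
Qed.

Lemma cpt_leq (a b : E -> nat) : cpt a -> cpt b -> cpt (fun e => a e <= b e).
Proof.
move=> [ra Ha] [rb Hb]; exists (RComp rleq [:: ra; rb]) => e.
exact: reval_comp2 (rleqP _ _) (Ha _) (Hb _).
Qed.

Lemma cpt_succ (a : E -> nat) : cpt a -> cpt (fun e => (a e).+1).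
Proof. by move=> [ra Ha]; exists (RComp RSucc [:: ra]) => e; apply: reval_succ. Qed.

Lemma cpt_iter A (eA : Enc A) (f : E -> A -> A) (x : E -> A) (n : E -> nat) :
  cpt (fun p : E * A => f p.1 p.2) -> cpt x -> cpt n ->
  cpt (fun e => iter (n e) (f e) (x e)).
Proof.
move=> [rf Hf] [rx Hx] [rn Hn].
exists (RComp (RRec rx (RComp rf [:: RComp rconsn [:: RProj 2; RProj 1]]))
   [:: rn; RProj 0]) => e.
apply: reval_comp2 _ (Hn e) (reval_proj (i := 0) _ _) => //.
elim: (n e : nat) => [|m IHm]; first exact: EvRec0 (Hx e).
apply: EvRecS IHm _; apply: reval_comp1 (Hf (e, _)) _.
by apply: reval_comp2 (rconsnP _ _) _ _; rproj.
Qed.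

Lemma cpt_foldr X A (eX : Enc X) (eA : Enc A) (f : E -> X -> A -> A)
    (z : E -> A) (s : E -> seq X) :
  cpt (fun p : E * X * A => f p.1.1 p.1.2 p.2) -> cpt z -> cpt s ->
  cpt (fun e => foldr (f e) (z e) (s e)).
Proof.
move=> [rf Hf] [rz Hz] [rs Hs].
(* The recursion sees the counter [n], the accumulator, the environment and the list. Since [foldr]
   consumes the list from its end, round [n] needs the element at position [size s - n.+1]. *)
pose relt := RComp rhd [:: RComp (riter rtl)
  [:: RComp rsub [:: RComp RSucc [:: RProj 0]; RComp rsize [:: RProj 3]]; RProj 3]].
pose rstep := RComp rf [:: RComp rconsn [:: RComp rconsn [:: RProj 2; relt]; RProj 1]].
exists (RComp (RRec (RComp rz [:: RProj 0]) rstep)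
  [:: RComp rsize [:: rs]; RProj 0; rs]) => e.
have szs : reval rsize [:: enc (s e)] (size (s e)).
  by rewrite -(size_map enc (s e)); apply: rsizeP.
apply: (reval_comp3 (a := size (s e)) (b := enc e) (c := enc (s e))); last first.
- exact: Hs.
- by rproj.
- exact: reval_comp1 szs (Hs e).
have Hn n : n <= size (s e) ->
  reval (RRec (RComp rz [:: RProj 0]) rstep) [:: n; enc e; enc (s e)]
    (enc (foldr (f e) (z e) (drop (size (s e) - n) (s e)))); last first.
  by have := Hn _ (leqnn _); rewrite subnn drop0.
elim: n => [|n IHn] ns.
  by rewrite subn0 drop_size; apply: EvRec0; apply: reval_comp1 (Hz e) _; rproj.
apply: EvRecS (IHn (ltnW ns)) _.
have lt_s : size (s e) - n.+1 < size (s e) by rewrite ltn_subrL (leq_trans _ ns).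
have [x [t Dt]] : exists x, exists t, drop (size (s e) - n.+1) (s e) = x :: t.
  by case: (drop _ _) (size_drop (size (s e) - n.+1) (s e)) => [/esym/eqP|x t _];
    [rewrite subn_eq0 leqNgt lt_s | exists x, t].
have -> : drop (size (s e) - n) (s e) = t.
  by rewrite -(subnSK ns) -[(_ - _).+1]add1n -drop_drop Dt /= drop0.
rewrite Dt /=; apply: reval_comp1 (Hf (e, x, _)) _.
apply: reval_comp2 (rconsnP _ _) _ _; last by rproj.
apply: reval_comp2 (rconsnP _ _) _ _; first by rproj.
apply: reval_comp1 (rhdP _ (enc t)) _.
have := rdropP (size (s e) - n.+1) (map (@enc X eX) (s e)); rewrite -map_drop Dt => Hd.
apply: reval_comp2 Hd _ _; last by rproj.
apply: reval_comp2 (rsubP _ _) _ _; first by apply: reval_succ; rproj.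
by apply: reval_comp1 szs _; rproj.
Qed.
End Cpt.

Lemma cpt_ext E X (eE : Enc E) (eX : Enc X) (f g : E -> X) : f =1 g -> cpt f -> cpt g.
Proof. by move=> fg [r Hr]; exists r => e; rewrite -fg. Qed.

(* Computability is proved by search along the syntax of the body. Constants are opaque to it, so
   each defined function gets its own lemma, which must be generalized over [E] before it applies
   under a binder; hence the sections closed and reopened below. *)
Create HintDb cpt.
#[local] Hint Constants Opaque : cpt.
(* [Equality.sort _] has to unfold to the carrier for [cpt_eq] to apply. *)
#[local] Hint Transparent Equality.sort Defs_term__canonical__eqtype_Equality
  Defs_builtin__canonical__eqtype_Equality Datatypes_sum__canonical__eqtype_Equality
  Datatypes_prod__canonical__eqtype_Equality Datatypes_list__canonical__eqtype_Equality
  Datatypes_nat__canonical__eqtype_Equality : cpt.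
#[local] Hint Resolve cpt_const cpt_id cpt_proj1 cpt_proj2 cpt_pair cpt_cons cpt_fst cpt_snd cpt_if
  cpt_eq cpt_leq cpt_succ cpt_iter cpt_foldr : cpt.
#[local] Hint Extern 1 (cpt _) => progress cbv beta : cpt.
#[local] Hint Extern 2 (cpt _) =>
  match goal with H : cpt ?t |- cpt (fun p => ?t (@?a p)) => refine (cpt_prim1 (a := a) H _) end : cpt.
Ltac cpt_auto := typeclasses eauto with cpt typeclass_instances.

Section CptList.
Variables (E : Type) (eE : Enc E).

Lemma cpt_and (a b : E -> bool) : cpt a -> cpt b -> cpt (fun e => a e && b e).
Proof.
by move=> Ha Hb; apply: (@cpt_ext _ _ _ _ (fun e => if a e then b e else false)); [done | cpt_auto].
Qed.

Lemma cpt_or (a b : E -> bool) : cpt a -> cpt b -> cpt (fun e => a e || b e).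
Proof.
by move=> Ha Hb; apply: (@cpt_ext _ _ _ _ (fun e => if a e then true else b e)); [done | cpt_auto].
Qed.

Lemma cpt_implb (a b : E -> bool) : cpt a -> cpt b -> cpt (fun e => a e ==> b e).
Proof.
by move=> Ha Hb; apply: (@cpt_ext _ _ _ _ (fun e => if a e then b e else true)); [done | cpt_auto].
Qed.

Lemma cpt_neg (a : E -> bool) : cpt a -> cpt (fun e => ~~ a e).
Proof.
by move=> Ha; apply: (@cpt_ext _ _ _ _ (fun e => if a e then false else true)); [done | cpt_auto].
Qed.

End CptList.
#[local] Hint Resolve cpt_and cpt_or cpt_implb cpt_neg : cpt.

Section CptList.
Variables (E X : Type) (eE : Enc E) (eX : Enc X).
Implicit Types (s t : E -> seq X).

Lemma cpt_cat s t : cpt s -> cpt t -> cpt (fun e => s e ++ t e).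
Proof.
move=> Hs Ht; apply: (@cpt_ext _ _ _ _ (fun e => foldr (fun x a => x :: a) (t e) (s e))).
  by move=> e; elim: (s e) => //= x u ->.
by cpt_auto.
Qed.

Lemma cpt_size s : cpt s -> cpt (fun e => size (s e)).
Proof.
move=> Hs; apply: (@cpt_ext _ _ _ _ (fun e => foldr (fun x a => a.+1) 0 (s e))).
  by move=> e; elim: (s e) => //= x u ->.
by cpt_auto.
Qed.

Lemma cpt_rcons s (a : E -> X) : cpt s -> cpt a -> cpt (fun e => rcons (s e) (a e)).
Proof.
move=> Hs Ha; apply: (@cpt_ext _ _ _ _ (fun e => foldr (fun x a => x :: a) [:: a e] (s e))).
  by move=> e; elim: (s e) => //= x u ->.
by cpt_auto.
Qed.

Lemma cpt_map Y (eY : Enc Y) (f : E -> X -> Y) s :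
  cpt (fun p : E * X => f p.1 p.2) -> cpt s -> cpt (fun e => map (f e) (s e)).
Proof.
move=> Hf Hs.
apply: (@cpt_ext _ _ _ _ (fun e => foldr (fun x a => f e x :: a) [::] (s e))).
  by move=> e; elim: (s e) => //= x u ->.
have Hf' : cpt (fun p : E * X * seq Y => f p.1.1 p.1.2).
  by apply: (cpt_prim1 Hf); cpt_auto.
by cpt_auto.
Qed.

Lemma cpt_filter (f : E -> X -> bool) s :
  cpt (fun p : E * X => f p.1 p.2) -> cpt s -> cpt (fun e => filter (f e) (s e)).
Proof.
move=> Hf Hs.
apply: (@cpt_ext _ _ _ _ (fun e => foldr (fun x a => if f e x then x :: a else a) [::] (s e))).
  by move=> e; elim: (s e) => //= x u ->.
have Hf' : cpt (fun p : E * X * seq X => f p.1.1 p.1.2).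
  by apply: (cpt_prim1 Hf); cpt_auto.
by cpt_auto.
Qed.

Lemma cpt_has (f : E -> X -> bool) s :
  cpt (fun p : E * X => f p.1 p.2) -> cpt s -> cpt (fun e => has (f e) (s e)).
Proof.
move=> Hf Hs.
apply: (@cpt_ext _ _ _ _ (fun e => foldr (fun x a => f e x || a) false (s e))).
  by move=> e; elim: (s e) => //= x u ->.
have Hf' : cpt (fun p : E * X * bool => f p.1.1 p.1.2).
  by apply: (cpt_prim1 Hf); cpt_auto.
by cpt_auto.
Qed.

Lemma cpt_all (f : E -> X -> bool) s :
  cpt (fun p : E * X => f p.1 p.2) -> cpt s -> cpt (fun e => all (f e) (s e)).
Proof.
move=> Hf Hs.
apply: (@cpt_ext _ _ _ _ (fun e => foldr (fun x a => f e x && a) true (s e))).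
  by move=> e; elim: (s e) => //= x u ->.
have Hf' : cpt (fun p : E * X * bool => f p.1.1 p.1.2).
  by apply: (cpt_prim1 Hf); cpt_auto.
by cpt_auto.
Qed.

Lemma cpt_behead s : cpt s -> cpt (fun e => behead (s e)).
Proof.
apply: cpt_prim1; exists rtl => u.
by have := rtl_codeP (map (@enc X eX) u); rewrite behead_map.
Qed.

Lemma cpt_head (x : X) s : cpt s -> cpt (fun e => head x (s e)).
Proof.
apply: cpt_prim1; exists (RComp rif [:: RProj 0; rhd; rconst (enc x)]) => -[|y u].
  by apply: reval_comp3 (rifP 0 0 (enc x)) _ rhd0 (rconstP _ _); rproj.
apply: (reval_comp3 (a := consn (enc y) (enc u)) (b := enc y) (c := enc x)).
- have := rifP (consn (@enc X eX y) (@enc _ (enc_seq eX) u)) (@enc X eX y) (@enc X eX x).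
  by rewrite (gtn_eqF (consn_gt0 _ _)).
- by rproj.
- exact: rhdP.
- exact: rconstP.
Qed.

End CptList.
#[local] Hint Resolve cpt_cat cpt_size cpt_rcons cpt_map cpt_filter cpt_has cpt_all
  cpt_behead cpt_head : cpt.

Section CptList.
Variables (E : Type) (eE : Enc E).

Lemma cpt_flatten X (eX : Enc X) (s : E -> seq (seq X)) :
  cpt s -> cpt (fun e => flatten (s e)).
Proof. by move=> Hs; rewrite /flatten; apply: cpt_foldr => //; cpt_auto. Qed.

Lemma cpt_nth X (eX : Enc X) (x : X) (s : E -> seq X) (n : E -> nat) :
  cpt s -> cpt n -> cpt (fun e => nth x (s e) (n e)).
Proof.
move=> Hs Hn.
apply: (@cpt_ext _ _ _ _ (fun e => head x (iter (n e) behead (s e)))); last by cpt_auto.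
move=> e; rewrite -nth0; elim: (n e) (s e) => [|m IHm] u //=.
by rewrite -iterS iterSr IHm; case: u => //=; rewrite nth_nil.
Qed.

Lemma cpt_iota0 (n : E -> nat) : cpt n -> cpt (fun e => iota 0 (n e)).
Proof.
move=> Hn; apply: (@cpt_ext _ _ _ _ (fun e => iter (n e) (fun s => rcons s (size s)) [::])).
  move=> e; elim: (n e) => // m IHm.
  by rewrite iterS IHm size_iota -cats1 -[m.+1]addn1 iotaD.
by cpt_auto.
Qed.

Lemma cpt_mem (X : eqType) (eX : Enc X) (a : E -> X) (s : E -> seq X) :
  cpt a -> cpt s -> cpt (fun e => a e \in s e).
Proof.
move=> Ha Hs; apply: (@cpt_ext _ _ _ _ (fun e => has (fun x => x == a e) (s e))).
  by move=> e; rewrite -has_pred1; apply: eq_has => x /=.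
by cpt_auto.
Qed.

Lemma cpt_count_mem (X : eqType) (eX : Enc X) (a : E -> X) (s : E -> seq X) :
  cpt a -> cpt s -> cpt (fun e => count_mem (a e) (s e)).
Proof.
move=> Ha Hs; apply: (@cpt_ext _ _ _ _ (fun e => size [seq x <- s e | x == a e])).
  by move=> e; rewrite size_filter.
by cpt_auto.
Qed.

Lemma cpt_rem (X : eqType) (eX : Enc X) (a : E -> X) (s : E -> seq X) :
  cpt a -> cpt s -> cpt (fun e => rem (a e) (s e)).
Proof.
move=> Ha Hs.
(* At the first occurrence [rem] returns the untouched tail, to which [foldr] gives no access; the
   fold therefore rebuilds the list itself along with the result. *)
pose f (e : E) (y : X) (p : seq X * seq X) := (y :: p.1, if y == a e then p.1 else y :: p.2).
apply: (@cpt_ext _ _ _ _ (fun e => (foldr (f e) ([::], [::]) (s e)).2)).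
  move=> e; suff -> : foldr (f e) ([::], [::]) (s e) = (s e, rem (a e) (s e)) by [].
  by elim: (s e) => //= y u ->.
by rewrite /f; cpt_auto.
Qed.

End CptList.
#[local] Hint Resolve cpt_flatten cpt_nth cpt_iota0 cpt_mem cpt_count_mem cpt_rem : cpt.

(** * Well-quasi-orders and multisets *)

(** Beyond every position some index attains the minimum of the tail; successive choices of such
    indices give values that never decrease. *)
Lemma nondecreasing_subsequence (f : nat -> nat) :
  exists g, (forall i j, i < j -> g i < g j) /\ (forall i j, i <= j -> f (g i) <= f (g j)).
Proof.
have tail_min n : exists m, n <= m /\ forall j, n <= j -> f m <= f j.
  have [v vP] : exists v, exists2 m, n <= m & f m <= v by exists (f n), n.
  elim: v vP => [|v IH] [m nm mv]; first by exists m; split=> // j _; move: mv; rewrite leqn0 => /eqP ->.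
  have [[j nj jv]|no] := classic (exists2 j, n <= j & f j <= v); first by apply: IH; exists j.
  exists m; split=> // j nj; apply: leq_trans mv _; rewrite ltnNge; apply/negP => jv.
  by apply: no; exists j.
pose p n := sval (constructive_indefinite_description _ (tail_min n)).
have pP n : n <= p n /\ forall j, n <= j -> f (p n) <= f j by rewrite /p; case: constructive_indefinite_description.
pose g := fix g i := if i is i'.+1 then p (g i').+1 else p 0.
have g_lt i : g i < g i.+1 by case: (pP (g i).+1).
have g_min i j : g i <= j -> f (g i) <= f j.
  case: i => [|i] gj; first by case: (pP 0) => _; apply.
  have [le_p min_p] := pP (g i).+1; exact/min_p/(leq_trans le_p gj).
have g_mono i j : i < j -> g i < g j.
  elim: j => // j IH; rewrite ltnS leq_eqVlt => /orP[/eqP -> //|/IH ij].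
  exact: ltn_trans ij (g_lt j).
exists g; split=> // i j; rewrite leq_eqVlt => /orP[/eqP -> //|/g_mono /ltnW].
exact: g_min.
Qed.

(** The sequence is thinned out one coordinate of [s] at a time; a nondecreasing coordinate remains
    so on further subsequences. *)
Lemma dickson (I : eqType) (s : seq I) (F : I -> nat -> nat) :
  exists i j, i < j /\ forall x, x \in s -> F x i <= F x j.
Proof.
suff [g [gm gF]] : exists g, (forall i j, i < j -> g i < g j) /\
    forall x, x \in s -> forall i j, i <= j -> F x (g i) <= F x (g j).
  by exists (g 0), (g 1); split=> [|x xs]; [apply: gm | apply: gF].
elim: s => [|x s [g [gm gF]]]; first by exists id.
have [h [hm hF]] := nondecreasing_subsequence (fun i => F x (g i)).
exists (fun i => g (h i)); split=> [i j /hm /gm //|y].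
rewrite inE => /orP[/eqP -> //|ys] i j; rewrite leq_eqVlt => /orP[/eqP -> //|/hm /ltnW].
exact: gF.
Qed.

Lemma dependent_choice (T : Type) (R : T -> T -> Prop) (I : T -> Prop) x0 :
  I x0 -> (forall x, I x -> exists y, R x y /\ I y) ->
  exists f : nat -> T, f 0 = x0 /\ forall i, I (f i) /\ R (f i) (f i.+1).
Proof.
move=> I0 H.
have next (x : {x | I x}) : {y : {y | I y} | R (sval x) (sval y)}.
  apply: constructive_indefinite_description; case: x => x Ix.
  by have [y [xy Iy]] := H x Ix; exists (exist _ y Iy).
pose f := fix f i := if i is i'.+1 then sval (next (f i')) else exist _ x0 I0.
exists (fun i => sval (f i)); split=> // i; split; first by case: (f i).
by rewrite /=; case: (next _).
Qed.

Lemma sumn_gt (s : seq nat) x : x \in s -> x < (sumn s).+1.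
Proof.
elim: s => //= y s IH; rewrite inE ltnS => /orP[/eqP ->|/IH]; first exact: leq_addr.
by rewrite ltnS => /leq_trans; apply; apply: leq_addl.
Qed.

(** Used to lift a rearrangement of the atoms of the CHR store to the identified constraints
    carrying them. *)
Lemma perm_map_inv (T U : eqType) (f : T -> U) s (t : seq U) :
  perm_eq (map f s) t -> exists2 s', perm_eq s s' & map f s' = t.
Proof.
elim: t s => [|y t IH] s p; first by exists s => //; apply/perm_nilP.
have /mapP[x xs yx] : y \in map f s by rewrite (perm_mem p) mem_head.
have [s' ps' s'E] : exists2 s', perm_eq (rem x s) s' & map f s' = t.
  apply: IH; rewrite -(perm_cons y) -(permPr p) perm_sym yx -map_cons.
  exact/perm_map/perm_to_rem.
by exists (x :: s'); rewrite /= ?s'E ?yx // (permPl (perm_to_rem xs)) perm_cons.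
Qed.

Lemma map_cat_inv (T U : Type) (f : T -> U) s (t u : seq U) : map f s = t ++ u ->
  exists s1 s2, [/\ s = s1 ++ s2, map f s1 = t & map f s2 = u].
Proof.
move=> E; exists (take (size t) s), (drop (size t) s).
by rewrite cat_take_drop map_take map_drop E take_size_cat ?drop_size_cat.
Qed.

Definition bounded_seqs (T : eqType) (s : seq T) n : seq (seq T) :=
  iter n (fun l => [::] :: [seq x :: u | x <- s, u <- l]) [:: [::]].

Lemma mem_bounded_seqs (T : eqType) (s : seq T) n u :
  size u <= n -> {subset u <= s} -> u \in bounded_seqs s n.
Proof.
elim: n u => [|n IH] [|x u] //= un us.
rewrite inE; apply/orP; right; apply/allpairsP; exists (x, u) => /=.
split=> //; first exact: us (mem_head _ _).
by apply: IH => // y yu; apply: us; rewrite inE yu orbT.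
Qed.

Lemma size_flatten_mem (T U : eqType) (f : T -> seq U) s x :
  x \in s -> size (f x) <= size (flatten (map f s)).
Proof.
elim: s => //= y s IH; rewrite inE size_cat => /orP[/eqP ->|/IH xs]; first exact: leq_addr.
exact: leq_trans xs (leq_addl _ _).
Qed.

(** * The abstract transition system *)

Section Algorithm.
Variable C : countType.
Implicit Types (t u : term C) (b : builtin C) (B : seq (builtin C)) (c : constr C) (r : rule C).

Lemma code_term_inj : injective (@code_term C).
Proof.
by case=> [x|x] [y|y] /(can_inj CodeSeq.codeK) // [] => [->|/(pcan_inj pickleK) ->].
Qed.
#[local] Instance enc_term : Enc (term C) := {| enc_inj := code_term_inj |}.

Lemma code_builtin_inj : injective (@code_builtin C).
Proof.
case=> [||t u] [||t' u'] /(can_inj CodeSeq.codeK) // [].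
by move=> /code_term_inj -> /code_term_inj ->.
Qed.
#[local] Instance enc_builtin : Enc (builtin C) := {| enc_inj := code_builtin_inj |}.

Lemma code_constr_inj : injective (@code_constr C).
Proof.
case=> [b|a] [b'|a'] /(can_inj CodeSeq.codeK) // [] => [/code_builtin_inj -> //|].
by move=> /(@enc_inj _ (enc_prod enc_nat (enc_seq enc_term))) ->.
Qed.
#[local] Instance enc_constr : Enc (constr C) := {| enc_inj := code_constr_inj |}.

Lemma code_rule_inj : injective (@code_rule C).
Proof.
case=> [k h g b] [k' h' g' b'] /(can_inj CodeSeq.codeK) [].
move=> /(can_inj CodeSeq.codeK) /(inj_map (@enc_inj _ (enc_prod enc_nat (enc_seq enc_term)))) ->.
move=> /(can_inj CodeSeq.codeK) /(inj_map (@enc_inj _ (enc_prod enc_nat (enc_seq enc_term)))) ->.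
move=> /(can_inj CodeSeq.codeK) /(inj_map code_builtin_inj) ->.
by move=> /(can_inj CodeSeq.codeK) /(inj_map code_constr_inj) ->.
Qed.
#[local] Instance enc_rule : Enc (rule C) := {| enc_inj := code_rule_inj |}.

Definition is_cst t : bool := if t is Cst _ then true else false.
Definition is_eq b : bool := if b is BEq _ _ then true else false.
Definition lhs b : term C := if b is BEq t _ then t else Var 0.
Definition rhs b : term C := if b is BEq _ t then t else Var 0.
Definition is_atom c : bool := if c is inr _ then true else false.
Definition the_builtin c : builtin C := if c is inl b then b else BTrue.
Definition the_atom c : atom C := if c is inr a then a else (0, [::]).

Lemma reval_if (b : bool) f g h xs n m :
  reval f xs b -> reval g xs n -> reval h xs m ->
  reval (RComp rif [:: f; g; h]) xs (if b then n else m).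
Proof.
by move=> Hb Hn Hm; apply: reval_comp3 Hb Hn Hm; have := rifP b n m; case: b.
Qed.

Lemma rhd_codeP n s : reval rhd [:: CodeSeq.code (n :: s)] n.
Proof. exact: rhdP. Qed.

Lemma rtl_consP n s : reval rtl [:: CodeSeq.code (n :: s)] (CodeSeq.code s).
Proof. exact: rtlP. Qed.

Section Primitives.
Variables (E : Type) (eE : Enc E).

Lemma cpt_is_cst (t : E -> term C) : cpt t -> cpt (fun e => is_cst (t e)).
Proof. apply: cpt_prim1; exists rhd => -[x|x]; [exact (rhd_codeP 0 [:: _])|exact (rhd_codeP 1 [:: _])]. Qed.

(** The tags of the three built-in forms are 0, 1 and 2, so the predecessor of the tag is the code
    of the answer. *)
Definition r_is_eq := RComp rpred [:: rhd].
Lemma r_is_eqP b : reval r_is_eq [:: enc b] (is_eq b).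
Proof.
case: b => [||t u]; [apply: (reval_comp1 (rpredP 0)) | apply: (reval_comp1 (rpredP 1)) |
  apply: (reval_comp1 (rpredP 2))]; exact: rhd_codeP.
Qed.

Lemma cpt_is_eq (b : E -> builtin C) : cpt b -> cpt (fun e => is_eq (b e)).
Proof. by apply: cpt_prim1; exists r_is_eq => ?; apply: r_is_eqP. Qed.

Lemma cpt_lhs (b : E -> builtin C) : cpt b -> cpt (fun e => lhs (b e)).
Proof.
apply: cpt_prim1.
exists (RComp rif [:: r_is_eq; RComp rhd [:: rtl]; rconst (enc (Var 0 : term C))]) => d.
have tag := r_is_eqP d; case: d tag => [||t u] tag.
- apply: (reval_if (b := false) (n := 0) tag _ (rconstP _ _)).
  exact: reval_comp1 rhd0 (rtl_consP _ [::]).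
- apply: (reval_if (b := false) (n := 0) tag _ (rconstP _ _)).
  exact: reval_comp1 rhd0 (rtl_consP _ [::]).
apply: (reval_if (b := true) (n := code_term t) tag _ (rconstP _ _)).
exact: reval_comp1 (rhd_codeP _ _) (rtl_consP _ _).
Qed.

Lemma cpt_rhs (b : E -> builtin C) : cpt b -> cpt (fun e => rhs (b e)).
Proof.
apply: cpt_prim1.
exists (RComp rif [:: r_is_eq; RComp rhd [:: RComp rtl [:: rtl]];
                      rconst (enc (Var 0 : term C))]) => d.
have tag := r_is_eqP d; case: d tag => [||t u] tag.
- apply: (reval_if (b := false) (n := 0) tag _ (rconstP _ _)).
  by apply: reval_comp1 rhd0 _; apply: reval_comp1 rtl0 (rtl_consP _ [::]).
- apply: (reval_if (b := false) (n := 0) tag _ (rconstP _ _)).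
  by apply: reval_comp1 rhd0 _; apply: reval_comp1 rtl0 (rtl_consP _ [::]).
apply: (reval_if (b := true) (n := code_term u) tag _ (rconstP _ _)).
by apply: reval_comp1 (rhd_codeP _ _) _; apply: reval_comp1 (rtl_consP _ _) (rtl_consP _ _).
Qed.

Lemma cpt_BEq (t u : E -> term C) : cpt t -> cpt u -> cpt (fun e => BEq (t e) (u e)).
Proof.
move=> [rt Ht] [ru Hu].
exists (RComp rconsn [:: rconst 2; RComp rconsn [:: rt; RComp rconsn [:: ru; RZero]]]) => e.
apply: reval_comp2 (rconsnP _ _) (rconstP _ _) _.
apply: reval_comp2 (rconsnP _ _) (Ht e) _.
by apply: reval_comp2 (rconsnP _ _) (Hu e) _; constructor.
Qed.

Lemma cpt_is_atom (c : E -> constr C) : cpt c -> cpt (fun e => is_atom (c e)).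
Proof. apply: cpt_prim1; exists rhd => -[x|x]; [exact (rhd_codeP 0 [:: _])|exact (rhd_codeP 1 [:: _])]. Qed.

Lemma cpt_the_builtin (c : E -> constr C) : cpt c -> cpt (fun e => the_builtin (c e)).
Proof.
apply: cpt_prim1.
exists (RComp rif [:: rhd; rconst (enc (BTrue : builtin C)); RComp rhd [:: rtl]]) => -[b|a].
  apply: (reval_if (b := false) (m := code_builtin b) (rhd_codeP 0 _) (rconstP _ _)).
  exact: reval_comp1 (rhd_codeP _ _) (rtl_consP _ _).
apply: (reval_if (b := true) (m := code_atom a) (rhd_codeP 1 _) (rconstP _ _)).
exact: reval_comp1 (rhd_codeP _ _) (rtl_consP _ _).
Qed.

Lemma cpt_the_atom (c : E -> constr C) : cpt c -> cpt (fun e => the_atom (c e)).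
Proof.
apply: cpt_prim1.
exists (RComp rif [:: rhd; RComp rhd [:: rtl]; rconst (enc ((0, [::]) : atom C))]) => -[b|a].
  apply: (reval_if (b := false) (n := code_builtin b) (rhd_codeP 0 _) _ (rconstP _ _)).
  exact: reval_comp1 (rhd_codeP _ _) (rtl_consP _ _).
apply: (reval_if (b := true) (n := code_atom a) (rhd_codeP 1 _) _ (rconstP _ _)).
exact: reval_comp1 (rhd_codeP _ _) (rtl_consP _ _).
Qed.

Lemma cpt_kept (r : E -> rule C) : cpt r -> cpt (fun e => kept (r e)).
Proof. by apply: cpt_prim1; exists rhd => d; apply: rhd_codeP. Qed.

Lemma cpt_removed (r : E -> rule C) : cpt r -> cpt (fun e => removed (r e)).
Proof.
by apply: cpt_prim1; exists (RComp rhd [:: rtl]) => d; apply: reval_comp1 (rhd_codeP _ _) (rtl_consP _ _).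
Qed.

Lemma cpt_guard (r : E -> rule C) : cpt r -> cpt (fun e => guard (r e)).
Proof.
apply: cpt_prim1; exists (RComp rhd [:: RComp rtl [:: rtl]]) => d.
by apply: reval_comp1 (rhd_codeP _ _) _; apply: reval_comp1 (rtl_consP _ _) (rtl_consP _ _).
Qed.

Lemma cpt_body (r : E -> rule C) : cpt r -> cpt (fun e => body (r e)).
Proof.
apply: cpt_prim1; exists (RComp rhd [:: RComp rtl [:: RComp rtl [:: rtl]]]) => d.
apply: reval_comp1 (rhd_codeP _ _) _; apply: reval_comp1 (rtl_consP _ _) _.
by apply: reval_comp1 (rtl_consP _ _) (rtl_consP _ _).
Qed.
End Primitives.
#[local] Hint Resolve cpt_is_cst cpt_is_eq cpt_lhs cpt_rhs cpt_BEq cpt_is_atom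
  cpt_the_builtin cpt_the_atom cpt_kept cpt_removed cpt_guard cpt_body : cpt.

(* [single] tells whether the Herbrand universe is a singleton, in which case
   all equations hold. *)
Variable single : bool.

Notation bind := (term C * term C)%type.
Notation env := (seq bind).
(* A cluster is what remains of one instance of a rule body (or of the initial
   goal); its environment maps the head terms of the rule to terms of the
   initial goal and of the program with the same value. *)
Notation cluster := (seq (constr C) * env)%type.
Notation state := (seq cluster * seq (builtin C))%type.
(* A store term [t] of the [i]-th cluster, with root [u], is [(i.+1, t, u)] if
   it is a variable and [(0, t, t)] if it is a constant. *)
Notation token := (nat * term C * term C)%type.
Notation matching := (seq (term C * token)).

(** An unbound term is its own root: the initial cluster has an empty environment, and its variables
    are roots. *)
Definition lookup (s : env) t : term C :=
  foldr (fun p d => if p.1 == t then p.2 else d) t s.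
Definition root_of (s : env) t : term C := if is_cst t then t else lookup s t.
Definition root_builtin (s : env) b : builtin C :=
  if is_eq b then BEq (root_of s (lhs b)) (root_of s (rhs b)) else b.

(* Composition of elementary substitutions, the last binding acting first. *)
Definition unifier_app (s : env) t : term C :=
  foldr (fun p u => if u == p.1 then p.2 else u) t s.

(* The terms of [X] are not to be bound. *)
Definition unify1 (X : seq (term C)) b (st : bool * env) : bool * env :=
  if b == BFalse then (false, st.2) else
  if is_eq b then
    if single || (unifier_app st.2 (lhs b) == unifier_app st.2 (rhs b)) then st else
    if ~~ is_cst (unifier_app st.2 (lhs b)) && (unifier_app st.2 (lhs b) \notin X) then
      (st.1, (unifier_app st.2 (lhs b), unifier_app st.2 (rhs b)) :: st.2) else
    if ~~ is_cst (unifier_app st.2 (rhs b)) && (unifier_app st.2 (rhs b) \notin X) then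
      (st.1, (unifier_app st.2 (rhs b), unifier_app st.2 (lhs b)) :: st.2) else
    (false, st.2)
  else st.
Definition unify X st D : bool * env := foldr (unify1 X) st D.

Definition builtin_terms (B : seq (builtin C)) : seq (term C) :=
  flatten [seq if is_eq b then [:: lhs b; rhs b] else [::] | b <- B].

Definition satisfiable B : bool := (unify [::] (true, [::]) B).1.
(** First [B] is solved with every variable bindable, then [D] with the terms of [B] protected:
    success means that [D] holds after a choice of the variables outside [B] alone, which is the
    existential quantification of [entails_ex]. *)
Definition entails B D : bool :=
  (unify (builtin_terms B) (true, (unify [::] (true, [::]) B).2) D).1.

Definition nth_cluster (W : seq cluster) i : cluster := nth ([::], [::]) W i.
Definition occurrences (W : seq cluster) : seq (nat * constr C) :=
  flatten [seq [seq (i, c) | c <- (nth_cluster W i).1] | i <- iota 0 (size W)].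
(** An emptied cluster stays in the list, so that the positions recorded in tokens remain valid. *)
Definition remove (W : seq cluster) (o : nat * constr C) : seq cluster :=
  [seq if i == o.1 then (rem o.2 (nth_cluster W i).1, (nth_cluster W i).2)
       else nth_cluster W i | i <- iota 0 (size W)].

Definition token_of (W : seq cluster) i t : token :=
  if is_cst t then (0, t, t) else (i.+1, t, root_of (nth_cluster W i).2 t).
Definition match_terms (W : seq cluster) i (ts us : seq (term C)) : matching :=
  [seq (nth (Var 0) ts j, token_of W i (nth (Var 0) us j)) | j <- iota 0 (size ts)].

Definition pick1 (h : atom C) (st : seq cluster * matching) :
    seq (seq cluster * matching) :=
  [seq (remove st.1 o, match_terms st.1 o.1 h.2 (the_atom o.2).2 ++ st.2)
     | o <- [seq o <- occurrences st.1 |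
          is_atom o.2 && ((the_atom o.2).1 == h.1) &&
          (size (the_atom o.2).2 == size h.2)]].
Definition picks (hs : seq (atom C)) st : seq (seq cluster * matching) :=
  foldr (fun h sts => flatten [seq pick1 h st | st <- sts]) [:: st] hs.

(** The condition for a matching substitution to exist: a constant of a head meets only itself, and
    a repeated head term meets the same token each time. *)
Definition consistent (l : matching) : bool :=
  all (fun p => (is_cst p.1 ==> (p.2.1.2 == p.1)) &&
                all (fun q => (p.1 == q.1) ==> (p.2 == q.2)) l) l.
Definition env_of (l : matching) : env := [seq (p.1, p.2.2) | p <- l].

(* The trivial equations record in the free variables of the built-in store the
   roots of the terms matched by the heads: guard checking depends on them. *)
Definition apply_state (a : state) r (st : seq cluster * matching) : state :=
  (rcons st.1 (body r, env_of st.2),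
   [seq BEq q.2 q.2 | q <- env_of st.2] ++ a.2).
(** Removed heads are picked first and kept heads among what is left, so that partners are distinct.
    The new clusters come from [st1], which puts the kept constraints back; only the matching comes
    from [st2]. *)
Definition succ_apply (a : state) r : seq state :=
  flatten [seq [seq apply_state a r (st1.1, st2.2) |
      st2 <- [seq st2 <- picks (kept r) st1 | consistent st2.2 &&
                entails a.2 (map (root_builtin (env_of st2.2)) (guard r))]]
    | st1 <- picks (removed r) (a.1, [::])].
Definition succ_solve (a : state) : seq state :=
  [seq (remove a.1 o,
        root_builtin (nth_cluster a.1 o.1).2 (the_builtin o.2) :: a.2)
     | o <- [seq o <- occurrences a.1 | ~~ is_atom o.2]].
(* [introduce] has no counterpart: every CHR constraint of a cluster counts as
   stored.  Built-in constraints are solved nondeterministically, since solving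
   one may be postponed forever. *)
Definition succ (P : program C) (a : state) : seq state :=
  [seq a' <- succ_solve a ++ flatten [seq succ_apply a r | r <- P]
     | satisfiable a'.2].

Definition start (G : goal C) : state := ([:: (G, [::])], [:: BTrue]).

Definition extend (P : program C) (h : seq state) : seq (seq state) :=
  [seq a :: h | a <- succ P (head (start [::]) h)].
(* The paths of length [n], most recent state first. *)
Definition paths (P : program C) (G : goal C) n : seq (seq state) :=
  iter n (fun hs => flatten [seq extend P h | h <- hs]) [:: [:: start G]].

Definition covers (a a' : state) : bool :=
  [&& all (fun c : cluster => count_mem c a.1 <= count_mem c a'.1) a.1,
      all (fun b => b \in a'.2) a.2 & all (fun b => b \in a.2) a'.2].
Definition self_covering (h : seq state) : bool :=
  has (fun a => covers a (head (start [::]) h)) (behead h).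
Definition covered P G n : bool := has self_covering (paths P G n).

(** * Computability of the search for a covering *)

Section CptAlgorithm.
Variables (E : Type) (eE : Enc E).

Lemma cpt_lookup (s : E -> env) (t : E -> term C) :
  cpt s -> cpt t -> cpt (fun e => lookup (s e) (t e)).
Proof.
move=> Hs Ht; apply: cpt_foldr => //.
by cpt_auto.
Qed.


Lemma cpt_root_of (s : E -> env) (t : E -> term C) :
  cpt s -> cpt t -> cpt (fun e => root_of (s e) (t e)).
Proof. by move=> Hs Ht; apply: cpt_if => //; [cpt_auto | apply: cpt_lookup]. Qed.
#[local] Hint Resolve cpt_root_of : cpt.

Lemma cpt_root_builtin (s : E -> env) (b : E -> builtin C) :
  cpt s -> cpt b -> cpt (fun e => root_builtin (s e) (b e)).
Proof. by move=> Hs Hb; rewrite /root_builtin; cpt_auto. Qed.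

Lemma cpt_unifier_app (s : E -> env) (t : E -> term C) :
  cpt s -> cpt t -> cpt (fun e => unifier_app (s e) (t e)).
Proof. by move=> Hs Ht; rewrite /unifier_app; cpt_auto. Qed.

Lemma cpt_builtin_terms (B : E -> seq (builtin C)) :
  cpt B -> cpt (fun e => builtin_terms (B e)).
Proof. by move=> HB; rewrite /builtin_terms; cpt_auto. Qed.

Lemma cpt_nth_cluster (W : E -> seq cluster) (i : E -> nat) :
  cpt W -> cpt i -> cpt (fun e => nth_cluster (W e) (i e)).
Proof. by move=> HW Hi; rewrite /nth_cluster; cpt_auto. Qed.
End CptAlgorithm.
#[local] Hint Resolve cpt_root_of cpt_root_builtin cpt_unifier_app cpt_builtin_terms
  cpt_nth_cluster : cpt.

Section CptAlgorithm.
Variables (E : Type) (eE : Enc E).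

Lemma cpt_unify1 (X : E -> seq (term C)) (b : E -> builtin C) (st : E -> bool * env) :
  cpt X -> cpt b -> cpt st -> cpt (fun e => unify1 (X e) (b e) (st e)).
Proof. by move=> HX Hb Hst; rewrite /unify1; cpt_auto. Qed.

Lemma cpt_occurrences (W : E -> seq cluster) :
  cpt W -> cpt (fun e => occurrences (W e)).
Proof. by move=> HW; rewrite /occurrences; cpt_auto. Qed.

Lemma cpt_remove (W : E -> seq cluster) (o : E -> nat * constr C) :
  cpt W -> cpt o -> cpt (fun e => remove (W e) (o e)).
Proof. by move=> HW Ho; rewrite /remove; cpt_auto. Qed.

Lemma cpt_token_of (W : E -> seq cluster) (i : E -> nat) (t : E -> term C) :
  cpt W -> cpt i -> cpt t -> cpt (fun e => token_of (W e) (i e) (t e)).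
Proof. by move=> HW Hi Ht; rewrite /token_of; cpt_auto. Qed.

Lemma cpt_consistent (l : E -> matching) : cpt l -> cpt (fun e => consistent (l e)).
Proof. by move=> Hl; rewrite /consistent; cpt_auto. Qed.

Lemma cpt_env_of (l : E -> matching) : cpt l -> cpt (fun e => env_of (l e)).
Proof. by move=> Hl; rewrite /env_of; cpt_auto. Qed.

Lemma cpt_covers (a a' : E -> state) :
  cpt a -> cpt a' -> cpt (fun e => covers (a e) (a' e)).
Proof. by move=> Ha Ha'; rewrite /covers; cpt_auto. Qed.
End CptAlgorithm.
#[local] Hint Resolve cpt_unify1 cpt_occurrences cpt_remove cpt_token_of
  cpt_consistent cpt_env_of cpt_covers : cpt.

Section CptAlgorithm.
Variables (E : Type) (eE : Enc E).

Lemma cpt_unify (X : E -> seq (term C)) (st : E -> bool * env)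
    (D : E -> seq (builtin C)) :
  cpt X -> cpt st -> cpt D -> cpt (fun e => unify (X e) (st e) (D e)).
Proof. by move=> HX Hst HD; rewrite /unify; cpt_auto. Qed.

Lemma cpt_match_terms (W : E -> seq cluster) (i : E -> nat) (ts us : E -> seq (term C)) :
  cpt W -> cpt i -> cpt ts -> cpt us ->
  cpt (fun e => match_terms (W e) (i e) (ts e) (us e)).
Proof. by move=> HW Hi Ht Hu; rewrite /match_terms; cpt_auto. Qed.

Lemma cpt_apply_state (a : E -> state) (r : E -> rule C) (st : E -> seq cluster * matching) :
  cpt a -> cpt r -> cpt st -> cpt (fun e => apply_state (a e) (r e) (st e)).
Proof. by move=> Ha Hr Hst; rewrite /apply_state; cpt_auto. Qed.

Lemma cpt_succ_solve (a : E -> state) : cpt a -> cpt (fun e => succ_solve (a e)).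
Proof. by move=> Ha; rewrite /succ_solve; cpt_auto. Qed.

Lemma cpt_self_covering (h : E -> seq state) :
  cpt h -> cpt (fun e => self_covering (h e)).
Proof. by move=> Hh; rewrite /self_covering; cpt_auto. Qed.
End CptAlgorithm.
#[local] Hint Resolve cpt_unify cpt_match_terms cpt_apply_state cpt_succ_solve
  cpt_self_covering : cpt.

Section CptAlgorithm.
Variables (E : Type) (eE : Enc E).

Lemma cpt_satisfiable (B : E -> seq (builtin C)) :
  cpt B -> cpt (fun e => satisfiable (B e)).
Proof. by move=> HB; rewrite /satisfiable; cpt_auto. Qed.

Lemma cpt_entails (B D : E -> seq (builtin C)) :
  cpt B -> cpt D -> cpt (fun e => entails (B e) (D e)).
Proof. by move=> HB HD; rewrite /entails; cpt_auto. Qed.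

Lemma cpt_pick1 (h : E -> atom C) (st : E -> seq cluster * matching) :
  cpt h -> cpt st -> cpt (fun e => pick1 (h e) (st e)).
Proof. by move=> Hh Hst; rewrite /pick1; cpt_auto. Qed.
End CptAlgorithm.
#[local] Hint Resolve cpt_satisfiable cpt_entails cpt_pick1 : cpt.

Section CptAlgorithm.
Variables (E : Type) (eE : Enc E).

Lemma cpt_picks (hs : E -> seq (atom C)) (st : E -> seq cluster * matching) :
  cpt hs -> cpt st -> cpt (fun e => picks (hs e) (st e)).
Proof. by move=> Hhs Hst; rewrite /picks; cpt_auto. Qed.
End CptAlgorithm.
#[local] Hint Resolve cpt_picks : cpt.

Section CptAlgorithm.
Variables (E : Type) (eE : Enc E).


Lemma cpt_succ_apply (a : E -> state) (r : E -> rule C) :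
  cpt a -> cpt r -> cpt (fun e => succ_apply (a e) (r e)).
Proof. by move=> Ha Hr; rewrite /succ_apply; cpt_auto. Qed.
End CptAlgorithm.
#[local] Hint Resolve cpt_succ_apply : cpt.

Section CptAlgorithm.
Variables (E : Type) (eE : Enc E).

Lemma cpt_succ_states (P : E -> program C) (a : E -> state) :
  cpt P -> cpt a -> cpt (fun e => succ (P e) (a e)).
Proof. by move=> HP Ha; rewrite /succ; cpt_auto. Qed.
End CptAlgorithm.
#[local] Hint Resolve cpt_succ_states : cpt.

Section CptAlgorithm.
Variables (E : Type) (eE : Enc E).


Lemma cpt_paths (P : E -> program C) (G : E -> goal C) (n : E -> nat) :
  cpt P -> cpt G -> cpt n -> cpt (fun e => paths (P e) (G e) (n e)).
Proof. by move=> HP HG Hn; rewrite /paths /extend /start; cpt_auto. Qed.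
End CptAlgorithm.
#[local] Hint Resolve cpt_paths : cpt.

Section CptAlgorithm.
Variables (E : Type) (eE : Enc E).


Lemma cpt_covered (P : E -> program C) (G : E -> goal C) (n : E -> nat) :
  cpt P -> cpt G -> cpt n -> cpt (fun e => covered (P e) (G e) (n e)).
Proof. by move=> HP HG Hn; rewrite /covered; cpt_auto. Qed.
End CptAlgorithm.

Definition stops P G n : bool := covered P G n || (size (paths P G n) == 0).

Lemma search_recfun : exists f, forall (x : program C * goal C) n,
  (forall m, m < n -> ~~ stops x.1 x.2 m) -> stops x.1 x.2 n ->
  reval f [:: code_instance x] (covered x.1 x.2 n).
Proof.
have [rc Hc] : cpt (fun e : nat * (program C * goal C) => covered e.2.1 e.2.2 e.1).
  by apply: cpt_covered; cpt_auto.
(* [RMu] looks for a zero, hence the negation: [true] is coded by 1. *)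
have [rs Hs] : cpt (fun e : nat * (program C * goal C) => ~~ stops e.2.1 e.2.2 e.1).
  by rewrite /stops; apply: cpt_neg; apply: cpt_or; [apply: cpt_covered | apply: cpt_eq;
    [apply: cpt_size; apply: cpt_paths |]]; cpt_auto.
(* An instance is coded as a list of two elements, a pair by a single [consn]; [rx] converts the
   former into the latter. *)
pose rx := RComp rconsn [:: rhd; RComp rhd [:: rtl]].
have Hx (x : program C * goal C) : reval rx [:: code_instance x] (enc x).
  apply: reval_comp2 (rconsnP _ _) (rhd_codeP _ _) _.
  exact: reval_comp1 (rhd_codeP _ _) (rtl_consP _ _).
pose rt (q : recfun) := RComp q [:: RComp rconsn [:: RProj 0; RComp rx [:: RProj 1]]].
have Ht (q : recfun) (F : nat * (program C * goal C) -> bool) n x :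
    (forall e, reval q [:: enc e] (enc (F e))) ->
    reval (rt q) [:: n; code_instance x] (F (n, x)).
  move=> Hr; apply: reval_comp1 (Hr (n, x)) _.
  apply: reval_comp2 (rconsnP _ _) _ _; first by rproj.
  by apply: reval_comp1 (Hx _) _; rproj.
exists (RComp (rt rc) [:: RMu (rt rs); RProj 0]) => x n Hlt Hn.
have Ac := Ht _ _ n x Hc; apply: reval_comp2 Ac _ _; last by rproj.
have As m := Ht _ _ m x Hs.
apply: (EvMu (z := fun=> 0)) => [m mn|]; first by have := As m; rewrite (Hlt m mn).
by have := As n; rewrite Hn.
Qed.

(** * Unification decides satisfiability and guard entailment *)

Lemma sat_eq (v w : nat -> C) B : {in fv B, w =1 v} -> sat w B = sat v B.
Proof.
move=> wv; apply: eq_in_all => b bB.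
case: b bB => // t u bB; have tw x : {subset tvars x <= bvars (BEq t u)} -> tval w x = tval v x.
  case: x => //= x /(_ x); rewrite inE eqxx => /(_ isT) xb.
  by apply: wv; apply/flattenP; exists (bvars (BEq t u)); rewrite ?map_f.
by rewrite /= !tw // => x xa; rewrite /= mem_cat xa ?orbT.
Qed.

Section Unification.
Hypothesis single_eq : single -> forall x y : C, x = y.
Hypothesis single_neq : ~~ single -> exists x y : C, x != y.
Variable c0 : C.
Implicit Types (D : seq (builtin C)) (s : env) (v w : nat -> C).

(** A semantic form of an idempotent most general unifier: the solutions of [B] are the valuations
    invariant under [s]. *)
Definition unifies s B : Prop :=
  [/\ forall d : C, unifier_app s (Cst d) = Cst d,
      forall w, sat w B <-> forall t, tval w (unifier_app s t) = tval w t
    & forall t, unifier_app s (unifier_app s t) = unifier_app s t].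

Lemma unifies_nil : unifies [::] [::].
Proof. by []. Qed.

Lemma unifies_ext s B D : (forall w, sat w B = sat w D) -> unifies s B -> unifies s D.
Proof. by move=> BD [u0 u1 u2]; split=> // w; rewrite -BD. Qed.

Lemma unifies_bind s B t u :
  unifies s B -> unifier_app s t != unifier_app s u -> ~~ is_cst (unifier_app s t) ->
  unifies ((unifier_app s t, unifier_app s u) :: s) (BEq t u :: B).
Proof.
move=> [u0 u1 u2] tu ct.
set s' := _ :: s.
have E x : unifier_app s' x =
    if unifier_app s x == unifier_app s t then unifier_app s u else unifier_app s x.
  by [].
have E' x : unifier_app s' (unifier_app s x) = unifier_app s' x by rewrite !E u2.
have Eu : unifier_app s' u = unifier_app s u by rewrite E; case: eqP.
split=> [c|w|x].
- by rewrite E u0; case: eqP ct => // <-.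
- rewrite (_ : sat w (BEq t u :: B) = (tval w t == tval w u) && sat w B) //; split.
    move=> /andP[/eqP wtu /u1 wB] x; rewrite E; case: eqP => [xt|_]; last exact: wB.
    by rewrite wB -wtu -(wB t) -xt wB.
  move=> H; apply/andP; split.
    by apply/eqP; rewrite -(H t) -(H u) Eu (E t) eqxx.
  by apply/u1 => x; rewrite -[LHS]H E' H.
- rewrite [unifier_app s' x]E; case: ifP => [_|nt]; first by rewrite E' Eu.
  by rewrite E' E nt.
Qed.

(** Idempotence makes every valuation a solution once it is precomposed with the unifier. *)
Lemma unifies_val s B v : unifies s B ->
  let w x := tval v (unifier_app s (Var x)) in
  sat w B /\ forall t, tval w t = tval v (unifier_app s t).
Proof.
move=> [u0 u1 u2] w.
have wE t : tval w t = tval v (unifier_app s t) by case: t => // c; rewrite u0.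
by split=> //; apply/u1 => t; rewrite !wE u2.
Qed.

(** The place where a second constant is required: in a singleton universe distinct terms have equal
    values. *)
Lemma separating (t u : term C) : ~~ single -> t != u -> exists v, tval v t != tval v u.
Proof.
move=> /single_neq [a [b ab]].
have other (c : C) : exists d, d != c.
  by have [ac|ac] := eqVneq a c; [exists b; rewrite -ac eq_sym | exists a].
case: t u => [x|c] [y|d] tu /=.
- exists (fun z => if z == x then a else b); rewrite eqxx.
  by have -> : (y == x) = false by apply: contraNF tu => /eqP ->.
- by have [e ed] := other d; exists (fun=> e).
- by have [e ed] := other c; exists (fun=> e); rewrite eq_sym.
- by exists (fun=> a); apply: contraNneq tu => ->.
Qed.

(** A new binding only replaces a term that is neither a constant nor in [X], so values of that kind
    survive; this is the second conclusion. *)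
Lemma unify_true X s B D : unifies s B -> (unify X (true, s) D).1 ->
  unifies (unify X (true, s) D).2 (D ++ B) /\
  forall t, is_cst (unifier_app s t) || (unifier_app s t \in X) ->
    unifier_app (unify X (true, s) D).2 t = unifier_app s t.
Proof.
move=> sB; elim: D => //= b D; case: (unify X (true, s) D) => ok s' /= IH.
have mono : (unify1 X b (ok, s')).1 -> ok.
  by rewrite /unify1; do ?case: ifP.
move=> H; have [s'D keep] := IH (mono H); move: H; rewrite /unify1 /=.
case: eqP => // bF; case: ifPn => [beq|]; last first.
  case: b bF {mono} => // _ _ _; split=> //; exact: unifies_ext s'D.
case: b beq bF {mono} => // t u _ _ /=.
have [s1|s0] /= := boolP single.
  move=> _; split=> //; apply: unifies_ext s'D => w /=.
  by rewrite (single_eq s1 (tval w t) (tval w u)) eqxx.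
have [tu|tu] /= := eqVneq.
  have [_ u1 _] := s'D; move=> _; split=> //; apply: unifies_ext s'D => w /=.
  by apply/idP/andP => [wD|[]] //; split=> //; apply/eqP; have H := (u1 w).1 wD; rewrite -(H t) tu H.
have keep' x y : ~~ is_cst (unifier_app s' x) && (unifier_app s' x \notin X) ->
    forall z, is_cst (unifier_app s z) || (unifier_app s z \in X) ->
    unifier_app ((unifier_app s' x, y) :: s') z = unifier_app s z.
  move=> /andP[xc xX] z zX; rewrite /= -/(unifier_app s' z) keep //.
  by case: eqP zX => // ->; rewrite (negbTE xc) (negbTE xX).
case: ifP => [/[dup] /keep' kt /andP[tc _]|_] /=.
  by move=> _; split; [apply: unifies_bind | apply: kt].
case: ifP => [/[dup] /keep' ku /andP[uc _]|_] //= _; split; last by apply: ku.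
apply: unifies_ext (unifies_bind s'D _ uc); last by rewrite eq_sym.
by move=> w /=; rewrite eq_sym.
Qed.

(** Apart from [BFalse], a failure opposes two distinct terms, each a constant or in [X]. A
    valuation separating them, composed with the unifier built so far, is the required [v]:
    agreement with it on [X] keeps the two clashing values different. *)
Lemma unify_false X s B D : unifies s B -> ~~ (unify X (true, s) D).1 ->
  exists v, sat v B /\ forall w, sat w B -> (forall x, Var x \in X -> w x = v x) ->
    ~~ sat w D.
Proof.
move=> sB; elim: D => //= b D IH; have := @unify_true X s B D sB.
case: (unify X (true, s) D) IH => -[] s' /= IH T H; last first.
  have [v [vB Hv]] := IH isT; exists v; split=> // w wB wv; rewrite negb_and.
  by rewrite Hv // orbT.
have [s'D _] := T isT; have [u0 u1 u2] := s'D.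
have satE w : sat w (D ++ B) = sat w D && sat w B by rewrite /sat all_cat.
have [vD _] := unifies_val (fun=> c0) s'D; move: vD; rewrite satE => /andP[_ vB].
move: H; rewrite /unify1 /=; case: eqP => [-> _|_]; first by eexists; split; first exact: vB.
case: ifP => // beq; case: b beq => // t u _ /=.
have [//|s0] /= := boolP single; have [//|tu] := eqVneq.
case: ifPn => // tX; case: ifPn => // uX _.
have [v0 v0tu] := separating s0 tu; have [vDB vE] := unifies_val v0 s'D.
move: vDB; rewrite satE => /andP[_ vB']; eexists; split; first exact: vB'.
move=> w wB wv; apply/negP => /andP[/eqP wtu wD].
have /u1 wA : sat w (D ++ B) by rewrite satE wD.
have wX x : ~~ (~~ is_cst (unifier_app s' x) && (unifier_app s' x \notin X)) ->
    tval w (unifier_app s' x) = tval v0 (unifier_app s' x).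
  rewrite negb_and !negbK => xX; rewrite -[in RHS]u2.
  case E: (unifier_app s' x) xX => [y|c] /=; last by rewrite u0.
  by move/wv ->.
by case/eqP: v0tu; rewrite -!wX // !wA.
Qed.

Lemma satisfiableP B : satisfiable B <-> exists v, sat v B.
Proof.
split=> [H|[v vB]].
  have [uB _] := unify_true unifies_nil H.
  by have [vB _] := unifies_val (fun=> c0) uB; rewrite cats0 in vB; eexists; exact: vB.
apply/negPn/negP => /(unify_false unifies_nil) [v' [_ Hv]].
by have /negP[] : ~~ sat v B by apply: Hv.
Qed.

Lemma builtin_termsP B x : (Var x \in builtin_terms B) = (x \in fv B).
Proof.
elim: B => //= b B IH; rewrite !mem_cat IH; congr orb.
case: b => // t u; rewrite /= !inE mem_cat.
by congr orb; case: t u => [y|c] [z|d]; rewrite /= ?inE.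
Qed.

(** Bindings introduce only constants and terms of [B], so the values that the first unification
    gives to terms of [B] are protected during the second. *)
Lemma unify_stable B (X : seq (term C)) : {subset builtin_terms B <= X} ->
  forall t, is_cst t || (t \in X) ->
    let u := unifier_app (unify [::] (true, [::]) B).2 t in is_cst u || (u \in X).
Proof.
elim: B => //= b B IH bX.
have {}IH : forall t, is_cst t || (t \in X) ->
    let u := unifier_app (unify [::] (true, [::]) B).2 t in is_cst u || (u \in X).
  by apply: IH => t tB; apply: bX; rewrite mem_cat tB orbT.
case: (unify _ _ B) IH => ok s /= IH t tX; rewrite /unify1 /=.
case: eqP => _; first exact: IH.
case: ifP => [beq|_]; last exact: IH.
have lX : lhs b \in X by apply: bX; rewrite /builtin_terms /= beq inE eqxx.
have rX : rhs b \in X by apply: bX; rewrite /builtin_terms /= beq !inE eqxx orbT.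
case: ifP => _; first exact: IH.
case: ifP => _ /=; first by case: ifP => _; apply: IH; rewrite ?rX ?orbT.
case: ifP => _ /=; first by case: ifP => _; apply: IH; rewrite ?lX ?orbT.
exact: IH.
Qed.

(** On success, precomposing [v] with the final unifier moves no variable of [B]: its value is
    protected, and [v] already solves [B]. On failure, [unify_false] gives a solution of [B] that no
    choice of the other variables extends to [D]. *)
Lemma entailsP B D : satisfiable B -> entails B D <-> entails_ex B D.
Proof.
move=> satB; have [uB _] := unify_true unifies_nil satB; rewrite cats0 in uB.
have [u0 u1 u2] := uB; rewrite /entails; set s := (unify [::] _ B).2 in uB u0 u1 u2 *.
split=> [H v vB|H].
  have [sD keep] := unify_true uB H; set s' := (unify _ _ D).2 in sD keep *.
  have [wDB wE] := unifies_val v sD.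
  move: wDB; rewrite /sat all_cat => /andP[wD _]; eexists; last exact: wD.
  move=> x xB; rewrite keep; first exact: ((u1 v).1 vB (Var x)).
  by apply: unify_stable; rewrite ?builtin_termsP ?xB ?orbT.
apply/negPn/negP => /(unify_false uB) [v [vB Hv]].
have [w wv wD] := H v vB; suff wB : sat w B.
  by have /negP[] : ~~ sat w D by apply: Hv => // x; rewrite builtin_termsP => /wv.
by rewrite (sat_eq wv).
Qed.
End Unification.

(** * Matching rule heads *)

Lemma nth_remove W o i : i < size W ->
  nth_cluster (remove W o) i =
  if i == o.1 then (rem o.2 (nth_cluster W i).1, (nth_cluster W i).2)
  else nth_cluster W i.
Proof. by move=> iW; rewrite /nth_cluster (nth_map 0) ?size_iota // nth_iota. Qed.

Lemma size_remove W o : size (remove W o) = size W.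
Proof. by rewrite size_map size_iota. Qed.

(** Positions and environments are kept, hence all tokens: a token found after some removals can be
    read in the original state. *)
Definition shrinks W' W : Prop :=
  [/\ size W' = size W,
      forall i, (nth_cluster W' i).2 = (nth_cluster W i).2
    & forall i, {subset (nth_cluster W' i).1 <= (nth_cluster W i).1}].

Lemma shrinks_refl W : shrinks W W. Proof. by split=> // i x. Qed.

Lemma shrinks_trans W' W W'' : shrinks W W' -> shrinks W' W'' -> shrinks W W''.
Proof.
move=> [s1 e1 c1] [s2 e2 c2]; split=> [|i|i x /c1]; [exact: etrans s1 s2 | exact: etrans (e1 i) (e2 i) | exact: c2].
Qed.

Lemma remove_shrinks W o : shrinks (remove W o) W.
Proof.
have out i : size W <= i -> nth_cluster (remove W o) i = nth_cluster W i.
  by move=> Wi; rewrite /nth_cluster !nth_default ?size_remove.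
split=> [|i|i]; first exact: size_remove.
  by case: (ltnP i (size W)) => [iW|/out -> //]; rewrite nth_remove //; case: eqP.
case: (ltnP i (size W)) => [iW|/out -> //]; rewrite nth_remove //.
by case: eqP => _ x //; apply: mem_rem.
Qed.

Implicit Types (W : seq cluster) (nu : nat -> nat -> nat) (th : term C -> term C)
  (st : seq cluster * matching) (a : state) (k : config C).

Definition ren (f : nat -> nat) x : term C := Var (f x).

Definition conc1 nu W i : seq (constr C) := map (csubst (ren (nu i))) (nth_cluster W i).1.
Definition conc nu W : seq (constr C) := flatten [seq conc1 nu W i | i <- iota 0 (size W)].
Definition conc_token nu (tk : token) : term C :=
  if tk.1.1 is i.+1 then tsubst (ren (nu i)) tk.1.2 else tk.1.2.

Lemma conc_token_of nu W i t : conc_token nu (token_of W i t) = tsubst (ren (nu i)) t.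
Proof. by case: t. Qed.

Lemma shrinks_token W' W i t : shrinks W' W -> token_of W' i t = token_of W i t.
Proof. by case=> _ e _; rewrite /token_of e. Qed.

Lemma mem_conc nu W c :
  reflect (exists2 i, i < size W & exists2 d, d \in (nth_cluster W i).1 & c = csubst (ren (nu i)) d)
          (c \in conc nu W).
Proof.
apply: (iffP flattenP) => [[s /mapP[i]]|[i iW [d dW ->]]].
  by rewrite mem_iota => iW -> /mapP[d dW ->]; exists i => //; exists d.
by exists (conc1 nu W i); rewrite ?map_f ?mem_iota.
Qed.

Lemma perm_conc_remove nu W i c : i < size W -> c \in (nth_cluster W i).1 ->
  perm_eq (conc nu W) (csubst (ren (nu i)) c :: conc nu (remove W (i, c))).
Proof.
move=> iW cW; have iI : i \in iota 0 (size W) by rewrite mem_iota.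
have E X : size X = size W ->
    perm_eq (conc nu X) (conc1 nu X i ++ flatten [seq conc1 nu X j | j <- rem i (iota 0 (size W))]).
  by move=> eX; rewrite /conc eX; apply: (perm_flatten (perm_map _ (perm_to_rem iI))).
apply: perm_trans (E _ erefl) _.
have := E _ (size_remove W (i, c)); rewrite perm_sym -(perm_cons (csubst (ren (nu i)) c)).
apply: perm_trans; rewrite -cat_cons.
have -> : [seq conc1 nu (remove W (i, c)) j | j <- rem i (iota 0 (size W))] =
          [seq conc1 nu W j | j <- rem i (iota 0 (size W))].
  apply/eq_in_map => j; rewrite mem_rem_uniq ?iota_uniq // inE mem_iota => /andP[ji jW].
  by rewrite /conc1 nth_remove //= (negbTE ji).
rewrite perm_cat2r /conc1 nth_remove //= eqxx -map_cons.
exact/perm_map/perm_to_rem.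
Qed.

Lemma mem_occurrences W o :
  (o \in occurrences W) = (o.1 < size W) && (o.2 \in (nth_cluster W o.1).1).
Proof.
apply/flattenP/andP => [[s /mapP[i]]|[iW cW]].
  by rewrite mem_iota => iW -> /mapP[d dW ->].
exists [seq (o.1, c) | c <- (nth_cluster W o.1).1]; last by case: o iW cW => i c _ /map_f.
by apply/mapP; exists o.1; rewrite ?mem_iota.
Qed.

Lemma mem_match_terms W i ts us p : size ts = size us ->
  p \in match_terms W i ts us -> p.1 \in ts /\ exists2 t, t \in us & p.2 = token_of W i t.
Proof.
move=> ss /mapP[j]; rewrite mem_iota /= => js ->; split; first exact: mem_nth.
by exists (nth (Var 0) us j) => //; rewrite mem_nth -?ss.
Qed.

Lemma match_terms_key W i ts us t : t \in ts -> exists tk, (t, tk) \in match_terms W i ts us.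
Proof.
move=> tts; eexists; apply/mapP; exists (index t ts); first by rewrite mem_iota index_mem.
by rewrite nth_index.
Qed.

Lemma match_termsP th nu W i ts us : size ts = size us ->
  (forall p, p \in match_terms W i ts us -> th p.1 = conc_token nu p.2) <->
  map th ts = map (tsubst (ren (nu i))) us.
Proof.
move=> ss; split=> [H|H p /mapP[j]].
  apply: (@eq_from_nth _ (Var 0)) => [|j]; first by rewrite !size_map.
  rewrite size_map => js; rewrite !(nth_map (Var 0)) -?ss //.
  have /H /= -> : (nth (Var 0) ts j, token_of W i (nth (Var 0) us j)) \in match_terms W i ts us.
    by apply/mapP; exists j; rewrite ?mem_iota.
  exact: conc_token_of.
rewrite mem_iota => js -> /=; rewrite conc_token_of -!(nth_map _ (Var 0)) -?ss //.
by rewrite H.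
Qed.

Definition occ_token W (tk : token) : Prop := exists i (d : atom C) t,
  [/\ i < size W, inr d \in (nth_cluster W i).1, t \in d.2 & tk = token_of W i t].

Lemma shrinks_occ_token W' W tk : shrinks W' W -> occ_token W' tk -> occ_token W tk.
Proof.
move=> sW [i [a [t [iW aW ta ->]]]]; exists i, a, t; rewrite (shrinks_token _ _ sW).
by case: sW iW => -> _ cW iW; split=> //; apply: cW.
Qed.

Definition inst th (h : atom C) : constr C := inr (h.1, map th h.2).

Lemma pick1P h st st' : st' \in pick1 h st -> exists i (d : atom C),
  [/\ i < size st.1, inr d \in (nth_cluster st.1 i).1, d.1 = h.1, size h.2 = size d.2
    & st' = (remove st.1 (i, inr d), match_terms st.1 i h.2 d.2 ++ st.2)].
Proof.
case/mapP=> -[i [b|a]]; rewrite mem_filter //= => /andP[/andP[/eqP e1 /eqP e2]].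
by rewrite mem_occurrences => /andP[iW aW] ->; exists i, a.
Qed.

(** Partners are picked without concrete data. By [picks_perm], any naming [nu] and instantiation
    [th] compatible with the matching turn this choice into a splitting of the concrete multiset. *)
Record picks_spec (hs : seq (atom C)) st st' : Prop := PicksSpec {
  picks_shrinks : shrinks st'.1 st.1;
  picks_sub : {subset st.2 <= st'.2};
  picks_new : forall p, p \in st'.2 -> p \in st.2 \/
    occ_token st.1 p.2 /\ exists2 h, h \in hs & p.1 \in h.2;
  picks_keys : forall h t, h \in hs -> t \in h.2 -> exists tk, (t, tk) \in st'.2;
  picks_perm : forall nu th, (forall p, p \in st'.2 -> th p.1 = conc_token nu p.2) ->
    perm_eq (conc nu st.1) (map (inst th) hs ++ conc nu st'.1) }.

Lemma picksP hs st st' : st' \in picks hs st -> picks_spec hs st st'.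
Proof.
elim: hs st' => [|h hs IH] st' /=; first by rewrite inE => /eqP ->; split=> // [|p]; [apply: shrinks_refl | left].
case/flattenP=> _ /mapP[st1 /IH [sh1 sub1 new1 keys1 perm1] ->].
case/pick1P=> i [a [iW aW e1 e2 ->]]; split=> /=.
- exact: shrinks_trans (remove_shrinks _ _) sh1.
- by move=> p /sub1 pst1; rewrite mem_cat pst1 orbT.
- move=> p; rewrite mem_cat => /orP[/(mem_match_terms e2)|/new1].
    case=> ph [t ta pt]; right; split; last by exists h; rewrite ?mem_head.
    by apply: shrinks_occ_token sh1 _; exists i, a, t.
  by case=> [|[pst [g ghs pg]]]; [left | right; split=> //; exists g; rewrite // inE ghs orbT].
- move=> g t; rewrite inE => /orP[/eqP -> th|/keys1 K /K [tk tkst]].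
    by have [tk tkh] := match_terms_key st1.1 i a.2 th; exists tk; rewrite mem_cat tkh.
  by exists tk; rewrite mem_cat tkst orbT.
- move=> nu th Hth; apply: perm_trans (perm1 nu th _) _.
    by move=> p pst; apply: Hth; rewrite mem_cat pst orbT.
  rewrite perm_sym -cat1s perm_catCA perm_cat2l perm_sym.
  apply: perm_trans (perm_conc_remove _ iW aW) _; rewrite /= /inst.
  have -> : map th h.2 = map (tsubst (ren (nu i))) a.2.
    by apply/(match_termsP th nu st1.1 i e2) => p ph; apply: Hth; rewrite mem_cat ph.
  by rewrite -e1.
Qed.

Lemma picks_complete nu th hs st M :
  (forall p, p \in st.2 -> th p.1 = conc_token nu p.2) ->
  perm_eq (conc nu st.1) (map (inst th) hs ++ M) ->
  exists2 st', st' \in picks hs st & perm_eq (conc nu st'.1) M /\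
    forall p, p \in st'.2 -> th p.1 = conc_token nu p.2.
Proof.
move=> Hst; elim: hs M => [|h hs IH] M /= pM; first by exists st; rewrite ?mem_head.
have {}pM : perm_eq (conc nu st.1) (map (inst th) hs ++ (inst th h :: M)).
  by apply: perm_trans pM _; rewrite -(cat1s _ M) -(cat1s _ (_ ++ M)) perm_catCA.
have [st1 st1P [p1 H1]] := IH _ pM.
have /mem_conc[i iW [d dW]] : inst th h \in conc nu st1.1.
  by rewrite (perm_mem p1) mem_head.
case: d dW => [b|a] // aW [e1 e2].
have e3 : size h.2 = size a.2 by have := congr1 size e2; rewrite !size_map.
exists (remove st1.1 (i, inr a), match_terms st1.1 i h.2 a.2 ++ st1.2); last split=> /=.
- apply/flattenP; exists (pick1 h st1); first exact: map_f.
  apply/mapP; exists (i, inr a) => //.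
  by rewrite mem_filter mem_occurrences /= iW aW e1 e3 !eqxx.
- rewrite -(perm_cons (inst th h)); apply: perm_trans p1; rewrite perm_sym.
  by rewrite /inst e1 e2; apply: (perm_conc_remove nu iW aW).
- move=> p; rewrite mem_cat => /orP[ph|/H1 //].
  exact: (proj2 (match_termsP th nu st1.1 i e3) e2 p ph).
Qed.

(** * Simulation *)

Lemma tval_subst (s : nat -> term C) (v : nat -> C) t :
  tval v (tsubst s t) = tval (fun x => tval v (s x)) t.
Proof. by case: t. Qed.

Lemma sat_subst (s : nat -> term C) (v : nat -> C) B :
  sat v (map (bsubst s) B) = sat (fun x => tval v (s x)) B.
Proof. by rewrite /sat all_map; apply: eq_all => -[||t u] //=; rewrite !tval_subst. Qed.

Lemma tval_eq (v w : nat -> C) t : {in tvars t, v =1 w} -> tval v t = tval w t.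
Proof. by case: t => //= x; apply; rewrite inE. Qed.

Lemma tsubst_eq (s s' : nat -> term C) t : {in tvars t, s =1 s'} -> tsubst s t = tsubst s' t.
Proof. by case: t => //= x; apply; rewrite inE. Qed.

Lemma bsubst_eq (s s' : nat -> term C) b : {in bvars b, s =1 s'} -> bsubst s b = bsubst s' b.
Proof.
case: b => //= t u ss.
by rewrite !(@tsubst_eq s s') // => x xt; apply: ss; rewrite mem_cat xt ?orbT.
Qed.

Lemma map_bsubst_eq (s s' : nat -> term C) B :
  {in fv B, s =1 s'} -> map (bsubst s) B = map (bsubst s') B.
Proof.
move=> ss; apply/eq_in_map => b bB; apply: bsubst_eq => x xb; apply: ss.
by apply/flattenP; exists (bvars b); rewrite ?map_f.
Qed.

Lemma tsubst_comp (s s' : nat -> term C) t :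
  tsubst s (tsubst s' t) = tsubst (fun x => tsubst s (s' x)) t.
Proof. by case: t. Qed.

Lemma bsubst_comp (s s' : nat -> term C) b :
  bsubst s (bsubst s' b) = bsubst (fun x => tsubst s (s' x)) b.
Proof. by case: b => //= t u; rewrite !tsubst_comp. Qed.

Lemma fv_subst (s : nat -> term C) B z :
  reflect (exists2 y, y \in fv B & z \in tvars (s y)) (z \in fv (map (bsubst s) B)).
Proof.
have tv t : reflect (exists2 y, y \in tvars t & z \in tvars (s y)) (z \in tvars (tsubst s t)).
  case: t => [x|d] /=; last by apply: (iffP idP) => // -[].
  by apply: (iffP idP) => [zx|[y]]; [exists x; rewrite ?inE | rewrite inE => /eqP ->].
apply: (iffP flattenP) => [[_ /mapP[_ /mapP[b bB ->] ->]]|[y /flattenP[_ /mapP[b bB ->]]]].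
  case: b bB => //= t u bB; have bvB := map_f (@bvars C) bB.
  by rewrite mem_cat => /orP[] /tv[y yt zy]; exists y => //; apply/flattenP;
    exists (bvars (BEq t u)); rewrite //= mem_cat yt ?orbT.
move=> yb zy; exists (bvars (bsubst s b)); first by rewrite map_f ?map_f.
case: b {bB} yb => //= t u; rewrite !mem_cat.
by case/orP=> yt; apply/orP; [left | right]; apply/tv; exists y.
Qed.

Lemma avars_ren f (d : atom C) : avars (asubst (ren f) d) = map f (avars d).
Proof.
rewrite /avars /= -map_comp map_flatten -map_comp; congr flatten.
by apply: eq_map => -[].
Qed.

Lemma cvars_ren f c : cvars (csubst (ren f) c) = map f (cvars c).
Proof. by case: c => [[||[x|x] [y|y]]|d] //=; apply: avars_ren. Qed.

Lemma root_ofE (s : env) t : root_of s t = tsubst (fun x => lookup s (Var x)) t.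
Proof. by case: t. Qed.

Lemma root_builtinE (s : env) b : root_builtin s b = bsubst (fun x => lookup s (Var x)) b.
Proof. by case: b => // t u; rewrite /root_builtin /= !root_ofE. Qed.

Lemma lookupP (s : env) t : (exists u, (t, u) \in s) -> (t, lookup s t) \in s.
Proof.
elim: s => [|[t' u'] s IH] /=; first by case.
rewrite inE xpair_eqE /= [t == t']eq_sym; have [tt|tt] /= := eqVneq; first by rewrite eqxx.
case=> u; rewrite inE xpair_eqE eq_sym (negbTE tt) /= => us.
by apply: IH; exists u.
Qed.

(* The constraints of [k] are the clusters of [a], the variable [x] of the
   [i]-th cluster being named [nu i x], together with the constraints [ex] that
   [a] ignores; [root y] is the term of the initial goal or of the program with
   which the built-in store identifies [y]. *)
Record simulates (ex : seq (constr C)) k a nu (root : nat -> term C) : Prop := Simulates {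
  sim_perm : perm_eq (cgoal k ++ map inr (chr (cstore k))) (conc nu a.1 ++ ex);
  sim_inj : forall i j c d x y, i < size a.1 -> j < size a.1 ->
    c \in (nth_cluster a.1 i).1 -> d \in (nth_cluster a.1 j).1 ->
    x \in cvars c -> y \in cvars d -> nu i x = nu j y -> i = j /\ x = y;
  sim_root : forall i c x, i < size a.1 -> c \in (nth_cluster a.1 i).1 -> x \in cvars c ->
    root (nu i x) = lookup (nth_cluster a.1 i).2 (Var x);
  sim_sat : forall v, sat v (map (bsubst root) (cbuilt k)) = sat v a.2;
  sim_fv : fv (map (bsubst root) (cbuilt k)) =i fv a.2;
  sim_idem : forall y, tsubst root (root y) = root y;
  sim_closed : forall y, y \in fv (cbuilt k) -> {subset tvars (root y) <= fv (cbuilt k)};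
  sim_base : forall y, root y = Var y \/ y \in fv (cbuilt k);
  sim_eq : forall v, sat v (cbuilt k) -> forall y, tval v (root y) = v y }.

Lemma config_varsP k c x : c \in cgoal k ++ map inr (chr (cstore k)) -> x \in cvars c ->
  x \in config_vars k.
Proof.
rewrite /config_vars !mem_cat => /orP[cG|/mapP[d dS ->]] xc.
  by rewrite (_ : x \in flatten _) //; apply/flattenP; exists (cvars c); rewrite ?map_f.
rewrite (_ : x \in flatten (map _ (chr _))) ?orbT //.
by apply/flattenP; exists (avars d); rewrite ?map_f.
Qed.

Section Simulates.
Variables (ex : seq (constr C)) (k : config C) (a : state).
Variables (nu : nat -> nat -> nat) (root : nat -> term C).
Hypothesis ka : simulates ex k a nu root.

Lemma sim_vars i c x : i < size a.1 -> c \in (nth_cluster a.1 i).1 -> x \in cvars c ->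
  nu i x \in config_vars k.
Proof.
move=> iW cW xc; apply: (@config_varsP _ (csubst (ren (nu i)) c)).
  rewrite (perm_mem (sim_perm ka)) mem_cat; apply/orP; left.
  by apply/mem_conc; exists i => //; exists c.
by rewrite cvars_ren map_f.
Qed.

Lemma mem_avars (d : atom C) t x : t \in d.2 -> x \in tvars t -> x \in avars d.
Proof. by move=> td xt; apply/flattenP; exists (tvars t); rewrite ?map_f. Qed.

Lemma token_root tk : occ_token a.1 tk -> tsubst root (conc_token nu tk) = tk.2.
Proof.
case=> i [d [t [iW dW td ->]]]; rewrite conc_token_of; case: t td => // x td.
by apply: (sim_root ka iW dW); apply: mem_avars td _; rewrite inE.
Qed.

Lemma token_vars tk : occ_token a.1 tk -> {subset tvars (conc_token nu tk) <= config_vars k}.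
Proof.
case=> i [d [t [iW dW td ->]]]; rewrite conc_token_of; case: t td => // x td y.
by rewrite inE => /eqP ->; apply: (sim_vars iW dW); apply: mem_avars td _; rewrite inE.
Qed.

(** Clusters are renamed apart, by [sim_inj], so syntactic matching can be decided on tokens. *)
Lemma token_inj tk tk' : occ_token a.1 tk -> occ_token a.1 tk' ->
  conc_token nu tk = conc_token nu tk' -> tk = tk'.
Proof.
case=> i [d [t [iW dW td ->]]] [j [d' [t' [jW dW' td' ->]]]]; rewrite !conc_token_of.
case: t td => [x|x] td; case: t' td' => [y|y] td' // [] E; last by rewrite E.
have [<- <-] // : i = j /\ x = y.
by apply: (sim_inj ka iW jW dW dW' _ _ E); [apply: mem_avars td _ | apply: mem_avars td' _];
  rewrite inE.
Qed.

Lemma token_cst tk d : occ_token a.1 tk -> conc_token nu tk = Cst d -> tk.1.2 = Cst d.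
Proof. by case=> i [d' [[x|x] [_ _ _ ->]]]; rewrite conc_token_of. Qed.

Lemma sim_failed : (exists v, sat v (cbuilt k)) <-> (exists v, sat v a.2).
Proof.
split=> -[v vB].
  exists v; rewrite -(sim_sat ka) sat_subst (@sat_eq v) // => x _.
  exact: (sim_eq ka vB).
by exists (fun x => tval v (root x)); rewrite -sat_subst (sim_sat ka).
Qed.

Lemma sat_cat (w : nat -> C) B B' : sat w (B ++ B') = sat w B && sat w B'.
Proof. exact: all_cat. Qed.

Lemma sat_subst_eqs (w : nat -> C) xs theta :
  sat w (subst_eqs xs theta) <-> forall x, x \in xs -> w x = tval w (theta x).
Proof.
rewrite /sat /subst_eqs all_map; split=> [/allP H x xx|H].
  by apply/eqP/H; rewrite mem_undup.
by apply/allP => x; rewrite mem_undup => xx; apply/eqP/H.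
Qed.

Section RuleInstance.
Variables (r : rule C) (rho : nat -> nat) (theta : nat -> term C) (e : env).
Hypothesis r_rr : rule_range_restricted r.
Hypothesis rho_fresh :
  forall x, x \in rule_vars (rename rho r) -> x \notin config_vars k.
Hypothesis theta_vars :
  forall x, x \in head_vars r -> {subset tvars (theta (rho x)) <= config_vars k}.
Hypothesis e_root :
  forall x, x \in head_vars r -> lookup e (Var x) = tsubst root (theta (rho x)).

Lemma head_vars_rename : head_vars (rename rho r) = map rho (head_vars r).
Proof.
rewrite /head_vars /heads /= -map_cat map_flatten -!map_comp; congr flatten.
by apply: eq_map => d; apply: avars_ren.
Qed.

Lemma head_vars_fresh x : x \in head_vars r -> rho x \notin config_vars k.
Proof. by move=> xr; apply: rho_fresh; rewrite mem_cat head_vars_rename map_f. Qed.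

Lemma built_vars x : x \in fv (cbuilt k) -> x \in config_vars k.
Proof. by move=> xB; rewrite /config_vars !mem_cat xB !orbT. Qed.

Lemma guard_head_vars x : x \in fv (guard r) -> x \in head_vars r.
Proof. by move=> xg; apply: r_rr; rewrite mem_cat orbC xg. Qed.

Lemma root_fixed y z : z \in tvars (root y) -> root z = Var z.
Proof.
move=> zy; have := sim_idem ka y.
by case: (root y) zy => // x; rewrite inE => /eqP <-.
Qed.

Lemma sat_guard (w : nat -> C) :
  sat w (map (root_builtin e) (guard r)) =
  sat (fun x => tval w (tsubst root (theta (rho x)))) (guard r).
Proof.
rewrite (eq_map (root_builtinE e)) sat_subst; apply: sat_eq => x /guard_head_vars xr /=.
by rewrite e_root.
Qed.

(** The equations of [theta] determine the renamed head variables, and range restriction leaves the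
    guard no others. After application of [root] both stores have the same solutions and free
    variables, so both sides quantify over the same choices. *)
Lemma sim_entails :
  entails_ex (cbuilt k)
    (subst_eqs (head_vars (rename rho r)) theta ++ guard (rename rho r)) <->
  entails_ex a.2 (map (root_builtin e) (guard r)).
Proof.
rewrite /entails_ex; split=> H v vB.
  have {}vB : sat (fun y => tval v (root y)) (cbuilt k) by rewrite -sat_subst (sim_sat ka).
  have [w wv] := H _ vB; rewrite sat_cat => /andP[/sat_subst_eqs weq wg].
  have wE z y : y \in fv (cbuilt k) -> z \in tvars (root y) -> w z = v z.
    by move=> yB zy; rewrite wv ?(sim_closed ka yB zy) // (root_fixed zy).
  exists w.
    by move=> z; rewrite -(sim_fv ka) => /fv_subst[y yB zy]; apply: wE zy.
  have wr y : tval w (root y) = w y.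
    have [-> //|yB] := sim_base ka y; rewrite wv //.
    by apply: tval_eq => z; apply: wE.
  have {}wg : sat (fun x => w (rho x)) (guard r) by move: wg; rewrite /= sat_subst.
  rewrite sat_guard (@sat_eq (fun x => w (rho x))) // => x /guard_head_vars xr /=.
  rewrite weq ?head_vars_rename ?map_f // tval_subst.
  by apply: tval_eq => y _; apply: wr.
have va : sat v a.2.
  rewrite -(sim_sat ka) sat_subst (@sat_eq v) // => x _; exact: (sim_eq ka vB).
have [w wv wg] := H v va.
(* The witness gives head variables the values imposed by [theta], keeps [v] on the store, and
   follows [w] elsewhere. Freshness separates the first case from the configuration. *)
pose w' y := if y \in head_vars (rename rho r) then tval w (tsubst root (theta y))
             else if y \in fv (cbuilt k) then v y else w y.
have w'C y : y \in config_vars k -> w' y = tval w (root y).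
  move=> yk; rewrite /w' ifN; last first.
    by apply/negP; rewrite head_vars_rename => /mapP[x /head_vars_fresh xk yx]; rewrite yx (negbTE xk) in yk.
  case: ifP => yB.
    rewrite -(sim_eq ka vB); apply: tval_eq => z zy; rewrite wv // -(sim_fv ka).
    by apply/fv_subst; exists y.
  by have [->|] := sim_base ka y; rewrite ?yB.
have w'H x : x \in head_vars r -> w' (rho x) = tval w (tsubst root (theta (rho x))).
  by move=> xr; rewrite /w' head_vars_rename map_f.
exists w'.
  move=> y yB; rewrite w'C ?built_vars // -(sim_eq ka vB).
  apply: tval_eq => z zy; rewrite wv // -(sim_fv ka).
  by apply/fv_subst; exists y.
rewrite sat_cat; apply/andP; split.
  apply/sat_subst_eqs => y; rewrite head_vars_rename => /mapP[x xr ->]; rewrite w'H //.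
  by rewrite tval_subst; apply: tval_eq => z /(theta_vars xr) /w'C.
rewrite sat_subst; rewrite sat_guard in wg.
by rewrite -(sat_eq (w := fun x => w' (rho x))) in wg => // x /guard_head_vars /w'H.
Qed.
End RuleInstance.
End Simulates.

Lemma sim_introduce ex k k' a nu root : introduce k k' ->
  simulates ex k a nu root -> simulates ex k' a nu root.
Proof.
case=> d G G' S B n pG ka; case: (ka) => p *; split=> //=.
apply: perm_trans p; rewrite /= perm_sym; apply: perm_trans (perm_cat pG (perm_refl _)) _.
by rewrite /= -cat1s -(cat1s _ (map _ (chr S))) perm_catCA.
Qed.

Lemma fv_cat B B' : fv (B ++ B') = fv B ++ fv B'.
Proof. by rewrite /fv map_cat flatten_cat. Qed.

(** Roots are not merged by a new equation, which is merely recorded between roots in the abstract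
    store; hence [nu] and [root] do not change. *)
Lemma sim_solve ex G G' S B n a nu root i b :
  simulates ex (Config G' S B n) a nu root ->
  i < size a.1 -> inl b \in (nth_cluster a.1 i).1 ->
  perm_eq G' (inl (bsubst (ren (nu i)) b) :: G) ->
  simulates ex (Config G S (bsubst (ren (nu i)) b :: B) n)
    (remove a.1 (i, inl b), root_builtin (nth_cluster a.1 i).2 b :: a.2) nu root.
Proof.
move=> ka iW bW pG; case: (ka) => /= p inj rt st fvE idem cl base eqv.
have [szR eR cR] := remove_shrinks a.1 (i, inl b).
have bE : bsubst root (bsubst (ren (nu i)) b) = root_builtin (nth_cluster a.1 i).2 b.
  rewrite root_builtinE bsubst_comp; apply: bsubst_eq => x xb /=.
  exact: (rt i _ x iW bW).
split=> //=.
- rewrite -(perm_cons (inl (bsubst (ren (nu i)) b))) -!cat_cons.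
  have {}pG := perm_cat pG (perm_refl (map inr (chr S))).
  rewrite -(permPl pG); apply: perm_trans p _; rewrite perm_cat2r.
  exact: (perm_conc_remove nu iW bW).
- by move=> j j' c d x y; rewrite szR => jW jW' /cR cW /cR dW; apply: (inj j j' c d x y).
- by move=> j c x; rewrite szR eR => jW /cR cW; apply: rt jW cW.
- by move=> v; rewrite bE; congr andb; apply: st.
- by move=> x; rewrite bE !mem_cat; congr orb; apply: fvE.
- move=> y; rewrite mem_cat => yB x xy; rewrite mem_cat.
  have [ry|yB'] := base y; last by rewrite orbC (cl y yB').
  by move: xy; rewrite ry inE => /eqP ->.
- by move=> y; rewrite mem_cat; case: (base y) => [|yB]; [left | right; rewrite orbC [X in X || _]yB].
- by move=> v /andP[_]; apply: eqv.
Qed.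

Lemma head_varsP r x : x \in head_vars r -> exists2 h, h \in heads r & Var x \in h.2.
Proof.
case/flattenP=> _ /mapP[h hr ->] /flattenP[_ /mapP[[y|d] th ->]] //.
by rewrite inE => /eqP ->; exists h.
Qed.

Lemma mem_head_vars r (h : atom C) x : h \in heads r -> Var x \in h.2 -> x \in head_vars r.
Proof.
move=> hr xh; apply/flattenP; exists (avars h); first exact: map_f.
by apply: mem_avars xh _; rewrite inE.
Qed.

Lemma body_vars_rename r rho : body_vars (rename rho r) = map rho (body_vars r).
Proof.
rewrite /body_vars /= map_flatten -!map_comp; congr flatten.
by apply: eq_map => c; apply: cvars_ren.
Qed.

Lemma map_inst_asubst theta rho (hs : seq (atom C)) :
  map inr (map (asubst theta) (map (asubst (ren rho)) hs)) =
  map (inst (fun t => tsubst theta (tsubst (ren rho) t))) hs.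
Proof. by rewrite -!map_comp; apply: eq_map => h; rewrite /inst /asubst /= -map_comp. Qed.

Section Application.
Variables (a : state) (r : rule C) (st1 st2 : seq cluster * matching).
Hypothesis pick_removed : st1 \in picks (removed r) (a.1, [::]).
Hypothesis pick_kept : st2 \in picks (kept r) st1.

Lemma matching_shrinks : shrinks st1.1 a.1.
Proof. exact: picks_shrinks (picksP pick_removed). Qed.

Lemma matching_tokens p : p \in st2.2 ->
  occ_token a.1 p.2 /\ exists2 h, h \in heads r & p.1 \in h.2.
Proof.
case/(picks_new (picksP pick_kept)).
  case/(picks_new (picksP pick_removed)) => // -[tk [h hr ph]]; split=> //.
  by exists h; rewrite // mem_cat hr orbT.
move=> [tk [h hr ph]]; split; first exact: shrinks_occ_token matching_shrinks tk.
by exists h; rewrite // mem_cat hr.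
Qed.

Lemma matching_keys h t : h \in heads r -> t \in h.2 -> exists tk, (t, tk) \in st2.2.
Proof.
rewrite mem_cat => /orP[hr|hr] th; first exact: (picks_keys (picksP pick_kept) hr th).
have [tk tk1] := picks_keys (picksP pick_removed) hr th.
by exists tk; apply: (picks_sub (picksP pick_kept)).
Qed.

Section Sim.
Variables (ex : seq (constr C)) (G : goal C) (S' : seq (atom C * nat)).
Variables (B : seq (builtin C)) (n : nat) (nu : nat -> nat -> nat) (root : nat -> term C).
Variables (rho : nat -> nat) (theta : nat -> term C).
Let k := Config G S' B n.
Let r' := rename rho r.
Let e := env_of st2.2.
Hypothesis ka : simulates ex k a nu root.
Hypothesis st2_theta : forall p, p \in st2.2 ->
  tsubst theta (tsubst (ren rho) p.1) = conc_token nu p.2.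

Lemma matching_theta_vars x : x \in head_vars r ->
  {subset tvars (theta (rho x)) <= config_vars k}.
Proof.
case/head_varsP=> h hr xh; have [tk tkst] := matching_keys hr xh.
have /= -> := st2_theta tkst; have [otk _] := matching_tokens tkst.
exact: (token_vars ka (tk := tk) otk).
Qed.

Lemma matching_root x : x \in head_vars r ->
  lookup e (Var x) = tsubst root (theta (rho x)).
Proof.
case/head_varsP=> h hr xh; have [tk tkst] := matching_keys hr xh.
have /lookupP : exists u, (Var x, u) \in e.
  by exists tk.2; apply/mapP; exists (Var x, tk).
case/mapP=> -[t tk'] tk'st [Et ->]; rewrite -Et in tk'st.
have /= -> := st2_theta tk'st; have [otk _] := matching_tokens tk'st.
by rewrite (token_root ka).
Qed.

Hypothesis r_rr : rule_range_restricted r.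
Hypothesis rho_inj : {in rule_vars r &, injective rho}.
Hypothesis rho_fresh : forall x, x \in rule_vars r' -> x \notin config_vars k.
Variables (H1 H2 S : seq (atom C * nat)).
Hypothesis S'_perm : perm_eq S' (H1 ++ H2 ++ S).
Hypothesis H2_perm : perm_eq (chr H2) (map (asubst theta) (removed r')).

Lemma sim_apply : exists nu' root',
  simulates ex (Config (body r' ++ G) (H1 ++ S) (subst_eqs (head_vars r') theta ++ B) n)
    (apply_state a r (st1.1, st2.2)) nu' root'.
Proof.
have [szW eW cW] := matching_shrinks; set W := st1.1 in szW eW cW *.
have fresh := head_vars_fresh rho_fresh.
have hvE := head_vars_rename r rho.
(* New head variables inherit the roots of the terms they are matched with, and the new cluster, in
   last position, is named by [rho]. By freshness nothing changes for old variables. *)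
pose root' y := if y \in head_vars r' then tsubst root (theta y) else root y.
pose nu' i := if i == size W then rho else nu i.
have root'C y : y \in config_vars k -> root' y = root y.
  by move=> yk; rewrite /root' hvE; case: mapP => // -[x /fresh xk yx]; rewrite -yx yk in xk.
have root'H x : x \in head_vars r -> root' (rho x) = tsubst root (theta (rho x)).
  by move=> xr; rewrite /root' hvE map_f.
have root'T x : x \in head_vars r ->
    tsubst root' (theta (rho x)) = tsubst root (theta (rho x)).
  by move=> xr; apply: tsubst_eq => y /(matching_theta_vars xr) /root'C.
(* Range restriction: every variable of the new cluster has a root in its environment. *)
have bodyH x : x \in body_vars r -> x \in head_vars r.
  by move=> xb; apply: r_rr; rewrite mem_cat xb.
have nthE i : nth_cluster (apply_state a r (W, st2.2)).1 i =
    if i < size W then nth_cluster W i else if i == size W then (body r, e) else ([::], [::]).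
  by rewrite /nth_cluster nth_rcons.
have newE : nth_cluster (apply_state a r (W, st2.2)).1 (size W) = (body r, e).
  by rewrite nthE ltnn eqxx.
have nu'E i : i < size W -> nu' i = nu i by rewrite /nu'; case: ltngtP.
have mem_body c x : c \in body r -> x \in cvars c -> x \in body_vars r.
  by move=> cb xc; apply/flattenP; exists (cvars c); rewrite ?map_f.
have mapB : map (bsubst root') B = map (bsubst root) B.
  by apply: map_bsubst_eq => y /(@built_vars k) /root'C.
have bodyR x : x \in body_vars r -> x \in rule_vars r by rewrite !mem_cat => ->; rewrite !orbT.
have oldnew i c d x y : i < size W -> c \in (nth_cluster W i).1 -> x \in cvars c ->
    d \in body r -> y \in cvars d -> nu i x <> rho y.
  move=> iW /cW cWi xc db yd E; have := fresh y (bodyH _ (mem_body _ _ db yd)).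
  by rewrite -E (sim_vars ka _ cWi xc) -?szW.
case: (ka) => /= p inj rt st fvE idem cl base eqv.
exists nu', root'; split=> /=.
- have cE : conc nu' (rcons W (body r, e)) = conc nu W ++ body r'.
    rewrite /conc size_rcons -addn1 iotaD map_cat flatten_cat; congr cat.
      congr flatten; apply/eq_in_map => i; rewrite mem_iota /= => iW.
      by rewrite /conc1 nu'E // [nth_cluster (rcons _ _) i]nthE iW.
    by rewrite /= cats0 /conc1 newE /nu' eqxx.
  have rP : perm_eq (conc nu a.1) (map inr (map (asubst theta) (removed r')) ++ conc nu W).
    rewrite map_inst_asubst; apply: (picks_perm (picksP pick_removed)) => q q1.
    by apply: st2_theta; apply: (picks_sub (picksP pick_kept)).
  have {}p : perm_eq (G ++ map inr (chr (H1 ++ S))) (conc nu W ++ ex).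
    rewrite -(perm_cat2l (map inr (map (asubst theta) (removed r')))).
    rewrite perm_sym catA -(permPl (perm_cat rP (perm_refl ex))) -(permPl p) perm_sym perm_catCA perm_cat2l.
    rewrite -(permPl (perm_cat (perm_map inr H2_perm) (perm_refl _))) -map_cat.
    apply: perm_map; rewrite /chr -map_cat; apply: perm_map.
    by rewrite (permPr S'_perm) perm_catCA.
  by rewrite cE -!catA perm_sym perm_catCA perm_cat2l perm_sym.
- move=> i j c d x y; rewrite size_rcons !ltnS !nthE.
  case: (ltngtP i (size W)) => // iW _; case: (ltngtP j (size W)) => // jW _ /= cWi dWj xc yd.
  + rewrite !nu'E // => E; apply: (inj i j c d) => //; rewrite -?szW //; exact: cW.
  + by rewrite (nu'E i iW) /nu' jW eqxx => /(oldnew _ _ _ _ _ iW cWi xc dWj yd).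
  + by rewrite (nu'E j jW) /nu' iW eqxx => /esym /(oldnew _ _ _ _ _ jW dWj yd cWi xc).
  + rewrite iW jW /nu' eqxx => E; split=> //; apply: rho_inj => //.
      exact/bodyR/(mem_body _ _ cWi xc).
    exact/bodyR/(mem_body _ _ dWj yd).
- move=> i c x; rewrite size_rcons ltnS !nthE; case: ltngtP => // iW _ /= cWi xc.
    have iA : i < size a.1 by rewrite -szW.
    by rewrite nu'E // eW root'C ?(rt i c) ?(sim_vars ka iA (cW _ _ cWi)) //; apply: cW.
  have xb := bodyH _ (mem_body _ _ cWi xc).
  by rewrite /nu' iW eqxx root'H // matching_root.
(* Under [root'] the equations of [theta] become trivial, like those added by [apply_state]. *)
- move=> v; rewrite map_cat !sat_cat mapB st; congr andb; apply/idP/idP => _.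
    by apply/allP => _ /mapP[q _ ->] /=.
  rewrite sat_subst; apply/sat_subst_eqs => y; rewrite hvE => /mapP[x xr ->].
  by rewrite root'H // -root'T // tval_subst.
(* The trivial equations of [apply_state] contribute the variables among the roots of the matched
   terms, just as the equations of [theta] do under [root']. *)
- move=> z; rewrite map_cat mapB !fv_cat !mem_cat fvE; congr orb.
  apply/fv_subst/flattenP => [[y /flattenP[_ /mapP[_ /mapP[y' y'r ->] ->]]]|].
    rewrite mem_undup hvE in y'r; case/mapP: y'r => x xr -> /= => zy zr.
    exists (tvars (lookup e (Var x)) ++ tvars (lookup e (Var x))).
      have [h hr xh] := head_varsP xr; have [tk tkst] := matching_keys hr xh.
      have /lookupP/(map_f (fun q => BEq q.2 q.2))/(map_f (@bvars C)) // : exists u, (Var x, u) \in e.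
      by exists tk.2; apply/mapP; exists (Var x, tk).
    rewrite matching_root // mem_cat orbb; move: zy zr; rewrite inE => /orP[/eqP ->|yt zr].
      by rewrite root'H.
    by rewrite -root'T //; case: (theta (rho x)) yt => //= w; rewrite inE => /eqP <-.
  case=> _ /mapP[_ /mapP[q /mapP[pq pst ->] ->] ->] /=; rewrite mem_cat orbb => zq.
  have [otk [h hr ph]] := matching_tokens pst; have Eth := st2_theta pst.
  case: pq pst otk ph Eth zq => -[x|d] tk /= pst otk ph Eth zq; last first.
    by move: zq; rewrite -(token_root ka otk) -Eth.
  have xr := mem_head_vars hr ph; exists (rho x); last first.
    by rewrite root'H // Eth (token_root ka).
  apply/flattenP; exists (bvars (BEq (Var (rho x)) (theta (rho x)))); last by rewrite inE eqxx.
  by rewrite map_f // (map_f (fun y => BEq (Var y) (theta y))) // mem_undup hvE map_f.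
- move=> y; have R t : {subset tvars t <= config_vars k} -> tsubst root' (tsubst root t) = tsubst root t.
    case: t => // y' y'k /=; rewrite -[RHS]idem; apply: tsubst_eq => z zy; apply: root'C.
    have [ry|y'B] := base y'; last exact: (@built_vars k _ (cl _ y'B _ zy)).
    by apply: y'k; rewrite ry in zy.
  rewrite /root'; case: ifP => [|yr]; rewrite -/root'.
    by rewrite hvE => /mapP[x xr ->]; apply: R; apply: matching_theta_vars.
  have [ry|yB] := base y; first by rewrite ry /= /root' yr.
  by apply: (R (Var y)) => z; rewrite inE => /eqP ->; apply: (@built_vars k).
- have eqsP y : y \in fv (subst_eqs (head_vars r') theta) -> exists2 x, x \in head_vars r &
      y = rho x \/ y \in tvars (theta (rho x)).
    case/flattenP=> _ /mapP[_ /mapP[y' y'r ->] ->]; rewrite mem_undup hvE in y'r.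
    case/mapP: y'r => x xr -> /=; rewrite inE => yx; exists x => //.
    by case/orP: yx => [/eqP|]; [left | right].
  have eqsT x : x \in head_vars r -> {subset tvars (theta (rho x)) <= fv (subst_eqs (head_vars r') theta)}.
    move=> xr z zx; apply/flattenP; exists (bvars (BEq (Var (rho x)) (theta (rho x)))); last first.
      by rewrite inE zx orbT.
    by rewrite map_f // (map_f (fun y => BEq (Var y) (theta y))) // mem_undup hvE map_f.
  have rootT x : x \in head_vars r ->
      {subset tvars (tsubst root (theta (rho x))) <= fv (subst_eqs (head_vars r') theta ++ B)}.
    move=> xr z; have := eqsT x xr; case: (theta (rho x)) => //= y' sub zy; rewrite fv_cat mem_cat.
    have [ry|y'B] := base y'; last by rewrite (cl _ y'B) ?orbT.
    by rewrite ry in zy; rewrite sub.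
  move=> y; rewrite fv_cat mem_cat => yB z zy.
  have [yr|yr] := boolP (y \in head_vars r').
    move: yr zy; rewrite hvE => /mapP[x xr ->]; rewrite root'H // => zx.
    by rewrite -hvE -fv_cat (rootT x).
  move: zy; rewrite /root' (negbTE yr) => zy; rewrite mem_cat.
  have [ry|yB'] := base y; last by rewrite (cl _ yB') ?orbT.
  by move: zy; rewrite ry inE => /eqP ->.
- move=> y; rewrite /root' fv_cat mem_cat; case: ifP => [yr|_].
    right; apply/orP; left; apply/flattenP; exists (bvars (BEq (Var y) (theta y))); last by rewrite inE eqxx.
    by rewrite map_f // (map_f (fun y => BEq (Var y) (theta y))) // mem_undup.
  by case: (base y) => [->|->]; [left | right; rewrite orbT].
- move=> v; rewrite sat_cat => /andP[/sat_subst_eqs veq vB] y; rewrite /root'.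
  case: ifP => [/veq ->|_]; last exact: eqv.
  by rewrite tval_subst; apply: tval_eq => z _; apply: eqv.
Qed.
End Sim.
End Application.

(** Surplus clusters of [a'] are moved into [ex]; stores equal as sets have the same solutions and
    free variables. *)
Lemma covers_simulates ex k a a' nu root :
  covers a a' -> simulates ex k a' nu root ->
  exists ex' nu', simulates ex' k a nu' root.
Proof.
case/and3P=> /allP cnt /allP sub1 /allP sub2 [p inj rt st fvE idem cl base eqv].
have /count_subseqP[s sub ps] : forall c : cluster, count_mem c a.1 <= count_mem c a'.1.
  by move=> c; have [/cnt //|/count_memPn -> //] := boolP (c \in a.1).
have [rest prest] := perm_to_subseq sub.
have pW : perm_eq (a.1 ++ rest) a'.1.
  by rewrite perm_sym; apply: perm_trans prest _; rewrite perm_cat2r perm_sym.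
(* [Is] lists the positions of [a'.1] in the order of [a.1 ++ rest], and transports the names of the
   clusters. *)
have [Is pIs IsE] := perm_iotaP ([::], [::]) pW.
pose f j := nth 0 Is j.
have szI : size Is = size a.1 + size rest by rewrite -size_cat IsE size_map.
have lt_I j : j < size a.1 -> j < size Is.
  by move=> ja; rewrite szI (leq_trans ja) ?leq_addr.
have lt_f j : j < size Is -> f j < size a'.1.
  by move=> ja; have := mem_nth 0 ja; rewrite (perm_mem pIs) mem_iota.
have uI : uniq Is by rewrite (perm_uniq pIs) iota_uniq.
have nthE j : j < size a.1 -> nth_cluster a.1 j = nth_cluster a'.1 (f j).
  move=> ja; have : nth ([::], [::]) (a.1 ++ rest) j = nth_cluster a'.1 (f j).
    by rewrite IsE (nth_map 0) ?lt_I.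
  by rewrite nth_cat ja.
pose nu' j := nu (f j).
exists (flatten [seq conc1 nu a'.1 (f j) | j <- iota (size a.1) (size rest)] ++ ex), nu'.
have sameE (B1 B2 : seq (builtin C)) : {subset B1 <= B2} -> forall v, sat v B2 -> sat v B1.
  by move=> BB v /allP vB; apply/allP => b /BB /vB.
have sameF (B1 B2 : seq (builtin C)) : {subset B1 <= B2} -> {subset fv B1 <= fv B2}.
  move=> BB x /flattenP[_ /mapP[b /BB bB ->] xb].
  by apply/flattenP; exists (bvars b); rewrite ?map_f.
split=> //.
- apply: perm_trans p _; rewrite catA perm_cat2r /conc.
  have -> : [seq conc1 nu' a.1 i | i <- iota 0 (size a.1)] =
            [seq conc1 nu a'.1 (f j) | j <- iota 0 (size a.1)].
    by apply/eq_in_map => j; rewrite mem_iota /= => ja; rewrite /conc1 nthE.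
  rewrite -flatten_cat -map_cat -iotaD -szI perm_sym.
  apply: perm_trans (perm_flatten (perm_map (conc1 nu a'.1) pIs)).
  by rewrite -{2}[Is](mkseq_nth 0) -map_comp.
- move=> i j c d x y ia ja; rewrite !nthE // => ci dj xc yd E.
  have [/eqP ij xy] := inj _ _ _ _ _ _ (lt_f _ (lt_I _ ia)) (lt_f _ (lt_I _ ja)) ci dj xc yd E.
  by split=> //; apply/eqP; rewrite -(nth_uniq 0 _ _ uI) ?lt_I.
- by move=> i c x ia; rewrite nthE // => ci xc; apply: (rt _ c) => //; apply/lt_f/lt_I.
- move=> v; rewrite st; apply/idP/idP; apply: sameE => b; [exact: sub1 | exact: sub2].
- move=> x; rewrite fvE; apply/idP/idP; apply: sameF => b; [exact: sub2 | exact: sub1].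
Qed.

Section Steps.
Hypothesis single_eq : single -> forall x y : C, x = y.
Hypothesis single_neq : ~~ single -> exists x y : C, x != y.
Variable c0 : C.
Variable P : program C.
Hypothesis P_rr : range_restricted P.

Let satP := satisfiableP single_eq single_neq c0.

(** As nothing is ignored, the constraints acted upon all lie in clusters. An introduction is
    invisible because clusters do not separate goal and store. *)
Lemma sim_complete k k' a nu root :
  step P k k' -> ~ failed k' -> simulates [::] k a nu root ->
  introduce k k' \/
  exists2 a', a' \in succ P a & exists nu' root', simulates [::] k' a' nu' root'.
Proof.
move=> kk' nf ka.
have succI a' : a' \in succ_solve a ++ flatten [seq succ_apply a r | r <- P] ->
    (exists nu' root', simulates [::] k' a' nu' root') ->
    exists2 a', a' \in succ P a & exists nu' root', simulates [::] k' a' nu' root'.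
  move=> a'in [nu' [root' ka']]; exists a'; last by exists nu', root'.
  rewrite mem_filter a'in andbT; apply/satP/(sim_failed ka').
  apply: NNPP => nsat; apply: nf => v; apply/negP => vB; apply: nsat; by exists v.
case: kk' => [kk'|kk'|kk']; [right | by left | right].
  case: kk' nf ka succI => b G G' S B n pG nf ka succI.
  have /mem_conc[i iW [[d dW []|//]]] : inl b \in conc nu a.1.
    by rewrite -[conc _ _]cats0 -(perm_mem (sim_perm ka)) mem_cat (perm_mem pG) mem_head.
  move=> bE; apply: succI; last first.
    by exists nu, root; rewrite bE; apply: (sim_solve ka iW dW); rewrite -bE.
  rewrite mem_cat; apply/orP; left; apply/mapP; exists (i, inl d) => //.
  by rewrite mem_filter mem_occurrences /= iW dW.
case: kk' nf ka succI => r rho theta G S S' H1 H2 B n r' eqs rP rho_inj fresh pS pH1 pH2 ent nf ka succI.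
pose th t := tsubst theta (tsubst (ren rho) t).
have chrS : perm_eq (map inr (chr S'))
    (map (inst th) (removed r) ++ map (inst th) (kept r) ++ map inr (chr S)).
  rewrite -!map_inst_asubst -!map_cat; apply: perm_map.
  rewrite /chr (permPl (perm_map _ pS)) !map_cat perm_catCA; apply: perm_cat => //.
  exact: perm_cat.
have p0 : perm_eq (conc nu a.1)
    (map (inst th) (removed r) ++ map (inst th) (kept r) ++ (G ++ map inr (chr S))).
  have := sim_perm ka; rewrite cats0 /= perm_sym => /perm_trans; apply.
  by rewrite (permPl (perm_cat (perm_refl G) chrS)) perm_catCA perm_cat2l perm_catCA.
have nil_ok p : p \in ([::] : matching) -> th p.1 = conc_token nu p.2 by [].
have [st1 st1P [p1 th1]] := picks_complete (st := (a.1, [::])) nil_ok p0.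
have [st2 st2P [_ th2]] := picks_complete th1 p1.
have tok p := matching_tokens st1P st2P (p := p).
have r_rr := P_rr rP.
apply: succI; last first.
  apply: (sim_apply st1P st2P ka th2 r_rr rho_inj fresh pS pH2).
rewrite mem_cat; apply/orP; right; apply/flattenP; exists (succ_apply a r); first exact: map_f.
apply/flattenP; eexists; first by apply/mapP; exists st1.
apply/mapP; exists st2 => //; rewrite mem_filter st2P andbT; apply/andP; split.
  (* Consistency follows from the concrete substitution: equal head terms have equal instances,
     hence equal tokens. *)
  apply/allP => p /[dup] /tok [op _] /[dup] /th2 Ep p2; apply/andP; split.
    by case: (p.1) Ep => //= d /esym /(token_cst op) ->.
  apply/allP => q /[dup] /tok [oq _] /th2 Eq; apply/implyP => /eqP pq; apply/eqP.
  by apply: (token_inj ka op oq); rewrite -Ep -Eq pq.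
apply/(entailsP single_eq single_neq c0).
  apply/satP/(sim_failed ka); apply: NNPP => nsat; apply: nf => v; apply/negP.
  by rewrite sat_cat => /andP[_ vB]; apply: nsat; exists v.
apply/(sim_entails ka r_rr fresh) => //.
  exact: (matching_theta_vars st1P st2P ka th2).
  exact: (matching_root st1P st2P ka th2).
exact: ent.
Qed.

Definition tlookup (l : matching) t : token :=
  foldr (fun p d => if p.1 == t then p.2 else d) (0, t, t) l.

Lemma tlookupP l p : consistent l -> p \in l -> tlookup l p.1 = p.2.
Proof.
move=> /allP cl pl.
have eqv q : q \in l -> q.1 = p.1 -> q.2 = p.2.
  by move=> ql /eqP qp; have /andP[_ /allP /(_ _ pl)] := cl q ql; rewrite qp => /eqP.
have {cl}: forall q, q \in l -> q.1 = p.1 -> q.2 = p.2 by [].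
elim: l pl {eqv} => //= q l IH; rewrite inE => pl H; case: eqP => [qp|qp].
  by apply: H => //; apply: mem_head.
case/orP: pl => [/eqP pq|pl]; first by rewrite pq in qp.
by apply: IH => // q' q'l; apply: H; rewrite inE q'l orbT.
Qed.

(** Abstract partners could be CHR constraints still in the goal; the assumption on [cgoal k] says
    that all of them have been introduced. *)
Lemma sim_sound ex k a a' nu root :
  simulates ex k a nu root -> all (predC is_atom) (cgoal k) -> satisfiable a.2 ->
  a' \in succ P a ->
  exists k' nu' root', step P k k' /\ simulates ex k' a' nu' root'.
Proof.
case: k => G S' B n ka Gb sa; rewrite mem_filter => /andP[_]; rewrite mem_cat => /orP[].
  case/mapP=> -[i [b|d]]; rewrite mem_filter mem_occurrences //= => /andP[iW bW] ->.
  have : csubst (ren (nu i)) (inl b) \in conc nu a.1 by apply/mem_conc; exists i => //; exists (inl b).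
  move=> bin; have : csubst (ren (nu i)) (inl b) \in G ++ map inr (chr S').
    by rewrite (perm_mem (sim_perm ka)) mem_cat bin.
  rewrite mem_cat => /orP[bG|/mapP[] //].
  have pG := perm_to_rem bG.
  exists (Config (rem (csubst (ren (nu i)) (inl b)) G) S' (bsubst (ren (nu i)) b :: B) n), nu, root.
  by split; [apply: Or31; constructor | apply: sim_solve ka iW bW pG].
case/flattenP=> _ /mapP[r rP ->] /flattenP[_ /mapP[st1 st1P ->] /mapP[st2]].
rewrite mem_filter => /andP[/andP[cons /(entailsP single_eq single_neq c0 _ sa) ent] st2P] ->.
(* [M] exceeds every variable in use, so the shift by [M] renames apart; [theta] undoes it by
   subtraction. *)
pose M := (sumn (config_vars (Config G S' B n))).+1; pose rho x := x + M.
pose theta y := conc_token nu (tlookup st2.2 (Var (y - M))).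
have th2 p : p \in st2.2 -> tsubst theta (tsubst (ren rho) p.1) = conc_token nu p.2.
  move=> pst; have [otk _] := matching_tokens st1P st2P pst.
  have := tlookupP cons pst; have /andP[] := allP cons p pst.
  case: (p.1) => [x|d] /=; first by rewrite /theta /rho addnK => _ _ ->.
  by move=> /eqP; case: otk => i [d' [[y|y] [_ _ _ ->]]] //= [->].
have r_rr := P_rr rP.
have rho_inj : {in rule_vars r &, injective rho} by move=> x y _ _ /addIn.
have fresh x : x \in rule_vars (rename rho r) -> x \notin config_vars (Config G S' B n).
  rewrite mem_cat head_vars_rename => xr.
  have {xr} : x \in map rho (rule_vars r).
    rewrite !map_cat !mem_cat; case/orP: xr => [-> //|].
    rewrite mem_cat body_vars_rename => /orP[xg|->]; last by rewrite !orbT.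
    suff -> : x \in map rho (guard_vars r) by rewrite orbT.
    case/fv_subst: xg => y yg; rewrite inE => /eqP ->; exact: map_f.
  by case/mapP=> y _ ->; apply/negP => /sumn_gt; rewrite -/M /rho ltnNge leq_addl.
pose th t := tsubst theta (tsubst (ren rho) t).
have p1 := picks_perm (picksP st1P) (nu := nu) (th := th)
  (fun p Hp => th2 p (picks_sub (picksP st2P) Hp)).
have p2 := picks_perm (picksP st2P) (th := th) th2.
have {p1 p2} pW := perm_trans p1 (perm_cat (perm_refl _) p2).
rewrite -!map_inst_asubst in pW.
set A2 := map (asubst theta) _ in pW; set A1 := map (asubst theta) _ in pW.
(* Keeping only atoms erases the goal, made of built-in constraints, and leaves the CHR store; the
   atoms of [ex] fall into the untouched part [S]. *)
pose atoms := pmap (fun c : constr C => if c is inr d then Some d else None).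
have atomsG : atoms G = [::] by elim: (G) Gb => //= -[d|d] G0 IH //= /IH.
have atomsK (s : seq (atom C)) : atoms (map inr s) = s by elim: s => //= d s ->.
have pS : perm_eq (chr S') (A2 ++ A1 ++ atoms (conc nu st2.1 ++ ex)).
  have := perm_pmap (fun c : constr C => if c is inr d then Some d else None)
    (perm_trans (sim_perm ka) (perm_cat pW (perm_refl ex))).
  by rewrite -/atoms /= /atoms !pmap_cat -/atoms atomsG !atomsK -!catA.
have [S'' pS'' /map_cat_inv[H2 [S3 [S''E H2E /map_cat_inv[H1 [S [S3E H1E _]]]]]]] := perm_map_inv pS.
have {}pS : perm_eq S' (H1 ++ H2 ++ S).
  by rewrite (permPl pS'') S''E S3E perm_catCA.
have pH2 : perm_eq (chr H2) A2 by rewrite /chr H2E.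
have pH1 : perm_eq (chr H1) A1 by rewrite /chr H1E.
have [nu' [root' ka']] := sim_apply st1P st2P ka th2 r_rr rho_inj fresh pS pH2.
eexists; exists nu', root'; split; last exact: ka'.
apply: Or33; apply: (Apply rP rho_inj fresh pS pH1 pH2).
apply/(sim_entails (e := env_of st2.2) ka r_rr fresh) => //.
  exact: (matching_theta_vars st1P st2P ka th2).
exact: (matching_root st1P st2P ka th2).
Qed.
End Steps.

(** * Termination of the search *)

Lemma pick1_size h st st' : st' \in pick1 h st -> size st'.2 = size h.2 + size st.2.
Proof.
by case/pick1P=> i [d [_ _ _ _ ->]]; rewrite size_cat size_map size_iota.
Qed.

(** An environment has one binding per argument of the heads, which bounds its length. *)
Lemma picks_size hs st st' : st' \in picks hs st ->
  size st'.2 = size (flatten (map snd hs)) + size st.2.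
Proof.
elim: hs st' => [|h hs IH] st' /=; first by rewrite inE => /eqP ->.
case/flattenP=> _ /mapP[st1 /IH IH1 ->] /pick1_size ->.
by rewrite IH1 size_cat addnA.
Qed.

Section Bounded.
Variables (P : program C) (G : goal C).

Definition constr_terms c : seq (term C) :=
  match c with inl b => builtin_terms [:: b] | inr d => d.2 end.
Definition all_constrs : goal C := G ++ flatten (map (@body C) P).
(** Heads and guards add nothing here: the root of a head term is that of an argument of the matched
    constraint, which stems from the goal or a body, and guards are not stored. *)
Definition all_terms : seq (term C) := flatten (map constr_terms all_constrs).
Definition rule_terms r : seq (term C) := flatten (map snd (heads r)).
Definition all_head_terms : seq (term C) := flatten (map rule_terms P).
Definition all_binds : env := [seq (t, u) | t <- all_head_terms, u <- all_terms].
Definition all_clusters : seq cluster :=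
  [seq (cs, e) | cs <- bounded_seqs all_constrs (size all_constrs),
                 e <- bounded_seqs all_binds (size all_head_terms)].
Definition all_builtins : seq (builtin C) :=
  [:: BTrue, BFalse & [seq BEq t u | t <- all_terms, u <- all_terms]].

Definition cluster_bounded (c : cluster) : Prop :=
  [/\ {subset c.1 <= all_constrs}, size c.1 <= size all_constrs,
      {subset c.2 <= all_binds} & size c.2 <= size all_head_terms].
Definition state_bounded a : Prop :=
  (forall i, i < size a.1 -> cluster_bounded (nth_cluster a.1 i)) /\
  {subset a.2 <= all_builtins}.

Lemma cluster_boundedP (c : cluster) : cluster_bounded c -> c \in all_clusters.
Proof.
case: c => cs e [/= H1 H2 H3 H4]; apply/allpairsP; exists (cs, e).
by split=> //; apply: mem_bounded_seqs.
Qed.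

Lemma mem_all_terms c t : c \in all_constrs -> t \in constr_terms c -> t \in all_terms.
Proof. by move=> cc tc; apply/flattenP; exists (constr_terms c); rewrite ?map_f. Qed.

Lemma root_of_bounded (e : env) t :
  {subset e <= all_binds} -> t \in all_terms -> root_of e t \in all_terms.
Proof.
move=> eb tT; rewrite /root_of; case: ifP => // _.
elim: e eb => //= p e IH eb; case: ifP => _; last by apply: IH => q qe; apply: eb; rewrite inE qe orbT.
by have /allpairsP[[x y] [_ yT ->]] := eb p (mem_head _ _).
Qed.

Lemma remove_bounded W o :
  (forall i, i < size W -> cluster_bounded (nth_cluster W i)) ->
  forall i, i < size (remove W o) -> cluster_bounded (nth_cluster (remove W o) i).
Proof.
move=> HW i; rewrite size_remove => iW; have [H1 H2 H3 H4] := HW i iW.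
rewrite nth_remove //; case: eqP => _ //; split=> //= [c /mem_rem /H1 //|].
apply: leq_trans H2; apply: size_subseq; exact: rem_subseq.
Qed.

Lemma picks_bounded hs st st' : st' \in picks hs st ->
  (forall i, i < size st.1 -> cluster_bounded (nth_cluster st.1 i)) ->
  forall i, i < size st'.1 -> cluster_bounded (nth_cluster st'.1 i).
Proof.
elim: hs st' => [|h hs IH] st' /=; first by rewrite inE => /eqP ->.
case/flattenP=> _ /mapP[st1 /IH {}IH ->] /pick1P[i [d [_ _ _ _ ->]]] /IH.
exact: remove_bounded.
Qed.

Lemma start_bounded : state_bounded (start G).
Proof.
split=> [[|i]|b] //=; last by rewrite inE => /eqP ->; apply: mem_head.
by move=> _; split=> //= [c cG|]; rewrite ?mem_cat ?cG // size_cat leq_addr.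
Qed.

Lemma succ_bounded a a' : state_bounded a -> a' \in succ P a -> state_bounded a'.
Proof.
move=> [aW aB]; rewrite mem_filter mem_cat => /andP[_ /orP[]].
  case/mapP=> -[i [b|d]]; rewrite mem_filter mem_occurrences //= => /andP[iW bW] ->.
  split; first exact: remove_bounded.
  move=> b'; rewrite inE => /orP[/eqP ->|/aB //]; have [H1 _ H3 _] := aW i iW.
  have bC := H1 _ bW; case: b {bW} bC => [||t u] bC; rewrite ?inE //=.
  apply/allpairsP.
  exists (root_of (nth_cluster a.1 i).2 t, root_of (nth_cluster a.1 i).2 u); split=> //=;
    apply: root_of_bounded => //; apply: mem_all_terms bC _; rewrite !inE eqxx ?orbT //.
case/flattenP=> _ /mapP[r rP ->] /flattenP[_ /mapP[st1 st1P ->] /mapP[st2]].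
rewrite mem_filter => /andP[_ st2P] ->.
have eT q : q \in env_of st2.2 -> q.1 \in all_head_terms /\ q.2 \in all_terms.
  case/mapP=> p pst ->; have [[i [d [t [iW dW td ->]]]] [h hr ph]] := matching_tokens st1P st2P pst.
  split=> /=.
    apply/flattenP; exists (rule_terms r); first exact: map_f.
    by apply/flattenP; exists h.2; rewrite ?map_f.
  have [H1 _ H3 _] := aW i iW; have tT := mem_all_terms (H1 _ dW) td.
  by rewrite /token_of; case: ifP => _ //=; apply: root_of_bounded.
split=> /= [i|b].
  rewrite size_rcons ltnS /nth_cluster nth_rcons => iW; case: ltngtP iW => // iW _.
    exact: (picks_bounded st1P aW).
  split=> /= [c cb||q /eT [q1 q2]|].
  - by rewrite mem_cat; apply/orP; right; apply/flattenP; exists (body r); rewrite ?map_f.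
  - by rewrite size_cat (leq_trans (size_flatten_mem (@body C) rP)) ?leq_addl.
  - by apply/allpairsP; exists q; case: q q1 q2.
  - rewrite size_map (picks_size st2P) (picks_size st1P) addn0 -size_cat -flatten_cat -map_cat.
    exact: size_flatten_mem.
rewrite mem_cat => /orP[/mapP[q /eT[_ qT] ->]|/aB //].
by rewrite !inE; apply/allpairsP; exists (q.2, q.2).
Qed.
End Bounded.

(** * Infinite computations, infinite abstract paths and coverings *)

Section Decision.
Hypothesis single_eq : single -> forall x y : C, x = y.
Hypothesis single_neq : ~~ single -> exists x y : C, x != y.
Variable c0 : C.
Variables (P : program C) (G : goal C).
Hypothesis P_rr : range_restricted P.

Lemma start_simulated : simulates [::] (initial G) (start G) (fun _ => id) (@Var C).
Proof.
have tV t : tsubst (@Var C) t = t by case: t.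
have bV b : bsubst (@Var C) b = b by case: b => //= t u; rewrite !tV.
have cV c : csubst (ren id) c = c.
  case: c => [b|[p ts]] /=; rewrite /ren; first by rewrite bV.
  by rewrite /asubst /= (eq_map tV) map_id.
split=> //=; try by left.
- by rewrite /conc /= /conc1 /= (eq_map cV) map_id !cats0.
- by move=> [|i] [|j].
- by move=> [|i].
Qed.

Lemma infinite_path (k : nat -> config C) : infinite_computation P G k ->
  exists A, A 0 = start G /\ forall i, A i.+1 \in succ P (A i).
Proof.
case=> k0 kS; pose I a := exists i nu root, simulates [::] (k i) a nu root.
have I0 : I (start G) by exists 0, (fun _ => id), (@Var C); rewrite k0; apply: start_simulated.
(* Introductions preserve the abstract state but shorten the goal; induction on its size reaches a
   step with an abstract counterpart. *)
have IS a : I a -> exists a', a' \in succ P a /\ I a'.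
  case=> i [nu [root]]; elim: {i}(size (cgoal (k i))) {-2}i (leqnn (size (cgoal (k i)))) => [|n IH] i.
    rewrite leqn0 size_eq0 => /eqP g0 ka; have [_ st] := kS i.
    have nf : ~ failed (k i.+1) by have [nfin _] := kS i.+1; move=> f; apply: nfin; left.
    have [intro|[a' a's [nu' [root' ka']]]] := sim_complete single_eq single_neq c0 P_rr st nf ka.
      by case: intro g0 => d g g' s b m pg /= g0; move: pg; rewrite g0 => /perm_size.
    by exists a'; split=> //; exists i.+1, nu', root'.
  move=> szn ka; have [_ st] := kS i.
  have nf : ~ failed (k i.+1) by have [nfin _] := kS i.+1; move=> f; apply: nfin; left.
  have [intro|[a' a's [nu' [root' ka']]]] := sim_complete single_eq single_neq c0 P_rr st nf ka.
    apply: (IH i.+1) (sim_introduce intro ka).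
    by case: intro szn => d g g' s b m /perm_size /= ->.
  by exists a'; split=> //; exists i.+1, nu', root'.
have [A [A0 AS]] := dependent_choice I0 IS.
by exists A; split=> // i; case: (AS i).
Qed.

Lemma path_covers A : A 0 = start G -> (forall i, A i.+1 \in succ P (A i)) ->
  exists i j, i < j /\ covers (A i) (A j).
Proof.
move=> A0 AS; have Ab i : state_bounded P G (A i).
  elim: i => [|i IH]; first by rewrite A0; apply: start_bounded.
  exact: succ_bounded IH (AS i).
(* Each built-in constraint gives two coordinates, for membership and non-membership, so that an
   inequality in both forces the stores to be equal as sets. *)
pose F (x : cluster + bool * builtin C) i : nat :=
  match x with inl c => count_mem c (A i).1 | inr (q, b) => (b \in (A i).2) == q end.
have [i [j [ij Fij]]] := dickson (map inl (all_clusters P G) ++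
  [seq inr (q, b) | q <- [:: true; false], b <- all_builtins P G]) F.
exists i, j; split=> //; have [Ai1 Ai2] := Ab i; have [Aj1 Aj2] := Ab j.
have inB b q : b \in all_builtins P G -> F (inr (q, b)) i <= F (inr (q, b)) j.
  move=> bB; apply: Fij; rewrite mem_cat; apply/orP; right.
  by apply/allpairsP; exists (q, b); rewrite /= !inE; case: q.
apply/and3P; split.
- apply/allP => c cA; apply: (Fij (inl c)); rewrite mem_cat map_f //.
  apply: cluster_boundedP; have := Ai1 (index c (A i).1); rewrite index_mem => /(_ cA).
  by rewrite /nth_cluster nth_index.
- by apply/allP => b bA; have := inB b true (Ai2 b bA); rewrite /= bA eqxx; case: (b \in _).
- by apply/allP => b bA; have := inB b false (Aj2 b bA); rewrite /= bA; case: (b \in _).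
Qed.

Lemma pathsSP n h : reflect
  (exists2 h', h' \in paths P G n & exists2 a, a \in succ P (head (start [::]) h') & h = a :: h')
  (h \in paths P G n.+1).
Proof.
apply: (iffP flattenP) => [[_ /mapP[h' h'n ->] /mapP[a ah' ->]]|[h' h'n [a ah' ->]]].
  by exists h' => //; exists a.
by exists (extend P h'); rewrite ?map_f.
Qed.

Lemma paths_prefix A n : A 0 = start G -> (forall i, A i.+1 \in succ P (A i)) ->
  [seq A (n - i) | i <- iota 0 n.+1] \in paths P G n.
Proof.
move=> A0 AS; elim: n => [|n IH]; first by rewrite /= A0 inE.
apply/pathsSP; exists [seq A (n - i) | i <- iota 0 n.+1] => //.
exists (A n.+1); first by rewrite /= subn0.
rewrite /= subn0; congr cons; rewrite subSS; congr cons.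
by rewrite (iotaDl 1 1) -map_comp; apply: eq_map => i; rewrite /= subSS.
Qed.

Lemma path_covered A : A 0 = start G -> (forall i, A i.+1 \in succ P (A i)) ->
  exists n, covered P G n.
Proof.
move=> A0 AS; have [i [j [ij cij]]] := path_covers A0 AS; exists j.
apply/hasP; exists [seq A (j - i) | i <- iota 0 j.+1]; first exact: paths_prefix.
apply/hasP; exists (A i); last by rewrite /= subn0.
apply/mapP; exists (j - i); last by rewrite subKn // ltnW.
by rewrite mem_iota add1n ltnS leq_subr subn_gt0 ij.
Qed.

Fixpoint extensible n a : Prop :=
  if n is n'.+1 then exists2 a', a' \in succ P a & extensible n' a' else True.

Lemma extensibleW m n a : m <= n -> extensible n a -> extensible m a.
Proof.
elim: n m a => [|n IH] [|m] a //= mn [a' a's a'n].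
by exists a' => //; apply: IH a'n.
Qed.

(** A state extensible to every depth has a successor of the same kind: otherwise the maximum of the
    bounds of its finitely many successors would bound its own depth. *)
Lemma koenig : (forall n, size (paths P G n) != 0) ->
  exists A, A 0 = start G /\ forall i, A i.+1 \in succ P (A i).
Proof.
move=> pn; pose live a := forall n, extensible n a.
have live0 : live (start G).
  move=> n; have [h hn] : exists h, h \in paths P G n.
    by case: (paths P G n) (pn n) => // h s _; exists h; apply: mem_head.
  have : extensible 0 (head (start [::]) h) by [].
  rewrite -[n]addn0; move: 0 => m; elim: n h hn m => [|n IH] h.
    by rewrite inE => /eqP ->.
  case/pathsSP=> h' h'n [a ah' ->] m am; rewrite addSnnS; apply: (IH h') => //.
  by exists a.
have liveS a : live a -> exists a', a' \in succ P a /\ live a'.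
  move=> la; apply: NNPP => no.
  have [N noN] : exists N, forall a', a' \in succ P a -> ~ extensible N a'.
    have : forall a', a' \in succ P a -> ~ live a' by move=> a' a's la'; apply: no; exists a'.
    elim: (succ P a) => [|b s IH] H; first by exists 0.
    have [|N HN] := IH; first by move=> a' a's; apply: H; rewrite inE a's orbT.
    have [M HM] := not_all_ex_not _ _ (H b (mem_head _ _)).
    exists (maxn M N) => a'; rewrite inE => /orP[/eqP -> |/HN {}HN] E.
      exact/HM/(extensibleW _ E)/leq_maxl.
    exact/HN/(extensibleW _ E)/leq_maxr.
  by have [a' a's] := la N.+1; apply: noN.
have [A [A0 AS]] := dependent_choice live0 liveS.
by exists A; split=> // i; case: (AS i).
Qed.

Fixpoint reaches n a z : Prop :=
  if n is n'.+1 then exists2 a', a' \in succ P a & reaches n' a' z else a = z.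

Lemma reaches_step n a z z' : reaches n a z -> z' \in succ P z -> reaches n.+1 a z'.
Proof.
elim: n a => [|n IH] a /=; first by move=> -> zz'; exists z'.
by case=> a' aa' a'z zz'; exists a' => //; apply: IH.
Qed.

Let satP := satisfiableP single_eq single_neq c0.

(** The [m.+1] of the second item guarantees that the loop between covering states has at least one
    step. *)
Lemma path_reaches n h : h \in paths P G n ->
  [/\ exists m, reaches m (start G) (head (start [::]) h),
      forall a, a \in behead h -> exists m, reaches m.+1 a (head (start [::]) h)
    & forall a, a \in h -> satisfiable a.2].
Proof.
elim: n h => [|n IH] h.
  rewrite inE => /eqP ->; split=> //; first by exists 0.
  by move=> a; rewrite inE => /eqP -> /=; apply/satP; exists (fun=> c0).
case/pathsSP=> h' /IH [[m sm] bh' sat'] [a ah' ->] /=; split.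
- by exists m.+1; apply: reaches_step sm ah'.
- move=> b bh; have [bb|] := boolP (b \in behead h').
    by have [m' bm'] := bh' _ bb; exists m'.+1; apply: reaches_step bm' ah'.
  case: h' bh ah' {bh' sat' sm} => //= x h'; rewrite inE => /orP[/eqP ->|->] // xa _.
  by exists 0, a.
- by move=> b; rewrite inE => /orP[/eqP ->|/sat' //]; move: ah'; rewrite mem_filter => /andP[].
Qed.

Lemma covered_infinite n : covered P G n -> exists k : nat -> config C, infinite_computation P G k.
Proof.
case/hasP=> h /path_reaches[[m0 sm0] bh sath] /hasP[c cb]; set z := head _ h => cz.
have [m1 cm1] := bh c cb.
have satc : satisfiable c.2 by apply: sath; exact: mem_behead cb.
(* Invariant: [k] simulates a state from which [z] is reachable. At [z] the covering lets [k] be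
   read as simulating [c], and the loop from [c] to [z] starts again with a new [ex]. *)
pose I k := exists ex a nu root m,
  [/\ simulates ex k a nu root, reaches m a z & satisfiable a.2].
have I0 : I (initial G).
  exists [::], (start G), (fun _ => id), (@Var C), m0; split=> //; exact: start_simulated.
have IS k : I k -> exists k', step P k k' /\ I k'.
  case=> ex [a [nu [root [m [ka am sa]]]]].
  have {ex a nu m ka am sa} [ex [a [nu [m [ka am sa]]]]] : exists ex a nu m,
      [/\ simulates ex k a nu root, reaches m.+1 a z & satisfiable a.2].
    case: m am => [az|m am]; last by exists ex, a, nu, m.
    rewrite /= in az; rewrite az in ka; have [ex' [nu' kc]] := covers_simulates cz ka.
    by exists ex', c, nu', m1.
  (* Introductions have priority: an abstract step is replayed only when the goal holds built-in
     constraints alone. *)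
  have [Gb|] := boolP (all (predC is_atom) (cgoal k)).
    case: am => a' aa' a'z.
    have [k' [nu' [root' [kk' ka']]]] := sim_sound single_eq single_neq c0 P_rr ka Gb sa aa'.
    exists k'; split=> //; exists ex, a', nu', root', m; split=> //.
    by move: aa'; rewrite mem_filter => /andP[].
  rewrite all_predC negbK => /hasP[[//|d] dG _].
  have kk' : introduce k (Config (rem (inr d) (cgoal k)) ((d, cnext k) :: cstore k) (cbuilt k) (cnext k).+1).
    by case: k ka dG => g s b i ka dG; constructor; apply: perm_to_rem.
  eexists; split; first by apply: Or32; exact: kk'.
  by exists ex, a, nu, root, m.+1; split=> //; apply: sim_introduce kk' ka.
have [k [k0 kS]] := dependent_choice I0 IS; exists k; split=> // i.
(* No configuration is final: the store is satisfiable, and with an empty goal the available step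
   must be a rule application. *)
have [[ex [a [nu [root [m [ka _ /satP sa]]]]]] st] := kS i; split=> // -[fk|[g0 noapp]].
  by have [v vB] := (sim_failed ka).2 sa; have := fk v; rewrite vB.
case: st => [st|st|st]; last by apply: noapp; exists (k i.+1).
  by case: st g0 => b g g' s B j pg /= g0; move: pg; rewrite g0 => /perm_size.
by case: st g0 => b g g' s B j pg /= g0; move: pg; rewrite g0 => /perm_size.
Qed.

End Decision.
End Algorithm.

Theorem theorem6 (C : countType) (hC : inhabited C) :
  decidable_on (@code_instance C)
    (fun x : program C * goal C => is_chr_program x.1 /\ range_restricted x.1)
    (fun x : program C * goal C =>
       exists k : nat -> config C, infinite_computation x.1 x.2 k).
Proof.
case: hC => c0.
(* This choice is classical but depends on [C] alone, so one recursive function serves all programs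
   and goals. *)
have [single [single_eq single_neq]] : exists single : bool,
    (single -> forall x y : C, x = y) /\ (~~ single -> exists x y : C, x != y).
  have [eqC|/not_all_ex_not[x /not_all_ex_not[y xy]]] := classic (forall x y : C, x = y).
    by exists true.
  by exists false; split=> // _; exists x, y; apply/eqP.
have [f fP] := search_recfun C single; exists f => -[P G] [_ /= P_rr].
have first_stop : (exists n, stops single P G n) ->
    exists2 n, stops single P G n & reval f [:: code_instance (P, G)] (covered single P G n).
  move=> ex_n; have [n Hn n_min] := ex_minnP ex_n; exists n => //.
  by apply: fP => // m mn; apply/negP => /n_min; rewrite leqNgt mn.
split=> [[k kP]|no_inf].
  have [A [A0 AS]] := infinite_path single_eq single_neq c0 P_rr kP.
  have [n cn] := path_covered A0 AS.
  have [|n' Hn'] := first_stop; first by exists n; rewrite /stops cn.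
  suff -> : covered single P G n' by [].
  case/orP: Hn' => // /eqP/size0nil p0.
  by have := paths_prefix n' A0 AS; rewrite p0.
have not_covered n : covered single P G n = false.
  apply/negP => cn; apply: no_inf.
  exact: (covered_infinite single_eq single_neq c0 P_rr cn).
have [|n _] := first_stop; last by rewrite not_covered.
(* If the search never stopped there would be paths of every length, hence an infinite one, which
   contains a covering. *)
apply: NNPP => no_stop; apply: no_inf.
have [|A [A0 AS]] := koenig (single := single) (P := P) (G := G).
  by move=> n; apply/negP => pn; apply: no_stop; exists n; rewrite /stops pn orbT.
have [n cn] := path_covered A0 AS; by rewrite not_covered in cn.
Qed.
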